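(* Let $t\ge2$ and $s\ge2$ be integers. Suppose that for each $\ell\in\{t,t+1\}$ there exist $\vartheta=\vartheta(\ell)>0$ and $N=N(\ell)>0$ such that $\mathbf{R}(\ell-1,n)\le\frac{\mathbf{R}(\ell,n)}{n^{\vartheta}}$ for every $n>N$. If $K_s$ has a phase transition from $\mathbf{Q}(t,n)$ to $\mathbf{Q}(t+1,n)$, then $K_s$ has a strong phase transition at $\mathbf{Q}(t,n)$.
   Context: All graphs are simple. $\mathbf{R}(t,m)$ is the Ramsey number, the minimum $n$ such that every graph on $n$ vertices contains a $K_t$ or an independent set of size $m$ (so $\mathbf{R}(1,m)=1$). For integers $t\ge2$, $\mathbf{Q}(t,n)$ is the minimum independence number over all $K_t$-free graphs on $n$ vertices. For a graph $H$ and a function $f$, $\mathbf{RT}(n,H,f(n))$ denotes the maximum number of edges of an $H$-free graph on $n$ vertices with independence number less than $f(n)$ (taken to be $0$ if no such graph exists). Set $\overline{\rho\tau}(H,f)=\limsup_{n\to\infty}\mathbf{RT}(n,H,f(n))/n^2$ and $\underline{\rho\tau}(H,f)=\liminf_{n\to\infty}\mathbf{RT}(n,H,f(n))/n^2$. Phase transitions: given a graph $H$ and functions $g(n)\le f(n)$, $H$ has a phase transition from $f$ to $g$ if $\overline{\rho\tau}(H,g)<\underline{\rho\tau}(H,f)$. Given a (positive) function $\varphi(n)\to0$, $H$ has a $\varphi$-phase-transition at $f$ if $H$ has a phase transition from $f$ to $\varphi f$. $H$ has a strong phase transition at $f$ if it has a $\varphi$-phase-transition at $f$ for every $\varphi$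 tending to $0$. *)

(* Defs.v *)
From HB Require Import structures.
From mathcomp Require Import all_boot all_order all_algebra.
From mathcomp Require Import all_classical all_reals all_analysis.

Set Implicit Arguments.
Unset Strict Implicit.
Unset Printing Implicit Defensive.

Import Order.TTheory GRing.Theory Num.Theory.
Import numFieldNormedType.Exports.

Local Open Scope nat_scope.

(* A simple graph on the vertex set T is given by its edges, which are
   unordered pairs of distinct vertices, i.e. subsets of T of size 2. *)
Record sgraph (T : finType) : Type := SGraph {
  edges : {set {set T}};
  edges_card2 : [forall e in edges, #|e| == 2]
}.

HB.instance Definition _ (T : finType) := [isSub for @edges T].
HB.instance Definition _ (T : finType) := [Finite of sgraph T by <:].

Definition adj (T : finType) (G : sgraph T) : rel T :=
  fun x y => [set x; y]%SET \in edges G.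

Lemma complete_proof (T : finType) :
  [forall e in [set e : {set T} | #|e| == 2]%SET, #|e| == 2].
Proof. by apply/forall_inP => e; rewrite inE. Qed.

Definition complete_on (T : finType) : sgraph T := SGraph (complete_proof T).

Definition complete (t : nat) : sgraph 'I_t := complete_on 'I_t.

Lemma edgeless_proof (T : finType) :
  [forall e in (finset.set0 : {set {set T}}), #|e| == 2].
Proof. by apply/forall_inP => e; rewrite inE. Qed.

Definition edgeless (T : finType) : sgraph T := SGraph (edgeless_proof T).

(* G contains H as a (not necessarily induced) subgraph. *)
Definition contains (V T : finType) (H : sgraph V) (G : sgraph T) : bool :=
  [exists f : {ffun V -> T}, injectiveb f &&
    [forall x, forall y, adj H x y ==> adj G (f x) (f y)]].

Definition graph_free (V T : finType) (H : sgraph V) (G : sgraph T) : bool :=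
  ~~ contains H G.

Definition independent (T : finType) (G : sgraph T) (A : {set T}) : bool :=
  [forall x in A, forall y in A, ~~ adj G x y].

Definition indep_num (T : finType) (G : sgraph T) : nat :=
  \max_(A : {set T} | independent G A) #|A|.

Definition ramsey_prop (t m n : nat) : bool :=
  [forall G : sgraph 'I_n, contains (complete t) G ||
    [exists A : {set 'I_n}, independent G A && (#|A| == m)]].

Lemma adjC (T : finType) (G : sgraph T) x y : adj G x y = adj G y x.
Proof. by rewrite /adj finset.setUC. Qed.

Lemma adjxx (T : finType) (G : sgraph T) x : adj G x x = false.
Proof.
apply/negP => xG; have /forall_inP/(_ _ xG) := edges_card2 G.
by rewrite cards2 eqxx.
Qed.

Lemma ramsey_aux (T : finType) (G : sgraph T) (t m : nat) (S : {set T}) :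
  'C(t + m, t) <= #|S| ->
  (exists2 A : {set T}, A \subset S &
     #|A| = t /\ {in A &, forall x y, x != y -> adj G x y}) \/
  (exists2 A : {set T}, A \subset S &
     #|A| = m /\ {in A &, forall x y, ~~ adj G x y}).
Proof.
elim: t m S => [|t IHt] m S.
  by left; exists finset.set0; rewrite ?finset.sub0set ?cards0; split=> // x y; rewrite inE.
elim: m S => [|m IHm] S.
  by right; exists finset.set0; rewrite ?finset.sub0set ?cards0; split=> // x y; rewrite inE.
move=> leS.
have /card_gt0P[v vS] : 0 < #|S| by apply: leq_trans leS; rewrite bin_gt0 leq_addr.
pose N := [set x in S | adj G v x]%SET.
pose M := (S :\ v :\: N)%SET.
have NS : N \subset (S :\ v)%SET.
  apply/fintype.subsetP => x; rewrite !inE => /andP[-> vx]; rewrite andbT.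
  by apply/eqP => xv; rewrite xv adjxx in vx.
have cardS : #|S| = (#|N| + #|M|).+1.
  rewrite (cardsD1 v S) vS add1n -(cardsID N (S :\ v)%SET).
  by rewrite (finset.setIidPr NS).
have /orP[leN|leM] : ('C(t + m.+1, t) <= #|N|) || ('C(t.+1 + m, t.+1) <= #|M|).
  rewrite -[_ || _]negbK negb_or -!ltnNge; apply/negP => /andP[ltN ltM].
  move: leS; rewrite cardS addSn binS.
  rewrite leqNgt => /negP; apply.
  rewrite addSnnS in ltM.
  by rewrite addnC -addSn -addnS leq_add.
- case: (IHt m.+1 N leN) => [[A AN [cA clA]]|[A AN [cA iA]]].
  + left; exists (v |: A)%SET.
      apply/fintype.subsetP => x; rewrite !inE => /orP[/eqP->//|/(fintype.subsetP AN)].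
      by rewrite inE => /andP[].
    have vA : v \notin A.
      by apply/negP => /(fintype.subsetP AN); rewrite inE adjxx andbF.
    split; first by rewrite cardsU1 vA cA.
    move=> x y; rewrite !inE => /orP[/eqP->|xA] /orP[/eqP->|yA]; first by rewrite eqxx.
    * by have := fintype.subsetP AN _ yA; rewrite inE => /andP[].
    * by have := fintype.subsetP AN _ xA; rewrite inE adjC => /andP[].
    * exact: clA.
  + right; exists A => //; apply: fintype.subset_trans AN _.
    by apply/fintype.subsetP => x; rewrite inE => /andP[].
- case: (IHm M leM) => [[A AM [cA clA]]|[A AM [cA iA]]].
  + left; exists A => //; apply: fintype.subset_trans AM _.
    by apply/fintype.subsetP => x; rewrite !inE => /and3P[].
  + right; exists (v |: A)%SET.
      apply/fintype.subsetP => x; rewrite !inE => /orP[/eqP->//|/(fintype.subsetP AM)].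
      by rewrite !inE => /and3P[].
    have nA x : x \in A -> ~~ adj G v x.
      move=> /(fintype.subsetP AM); rewrite !inE => /and3P[+ _ xS].
      by rewrite xS.
    have vA : v \notin A.
      by apply/negP => /(fintype.subsetP AM); rewrite !inE eqxx andbF.
    split; first by rewrite cardsU1 vA cA.
    move=> x y; rewrite !inE => /orP[/eqP->|xA] /orP[/eqP->|yA].
    * by rewrite adjxx.
    * exact: nA.
    * by rewrite adjC; exact: nA.
    * exact: iA.
Qed.

Lemma ramsey_exists (t m : nat) : exists n, ramsey_prop t m n.
Proof.
exists 'C(t + m, t); apply/forallP => G; apply/orP.
have := @ramsey_aux _ G t m [set: _]%SET; rewrite cardsT card_ord.
case=> // [[A _ [cA clA]]|[A _ [cA iA]]]; [left|right]; last first.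
  apply/existsP; exists A; rewrite cA eqxx andbT.
  by apply/forall_inP => x xA; apply/forall_inP => y yA; exact: iA.
pose f := [ffun i : 'I_t => enum_val (cast_ord (esym cA) i)].
have injf : injective f.
  by move=> i j; rewrite !ffunE => /enum_val_inj /cast_ord_inj.
apply/existsP; exists f; apply/andP; split; first exact/injectiveP.
apply/forallP => x; apply/forallP => y; apply/implyP => xy.
apply: clA; rewrite ?ffunE ?enum_valP //.
by apply/eqP => /enum_val_inj /cast_ord_inj exy; rewrite exy adjxx in xy.
Qed.

Definition ramsey (t m : nat) : nat := ex_minn (ramsey_exists t m).

(* For t >= 2 the edgeless graph is K_t-free, so that the minimum is indeed
   taken over the K_t-free graphs on n vertices; its value for t < 2 is
   meaningless. *)
Definition Qmin (t n : nat) : nat :=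
  indep_num [arg min_(G < edgeless 'I_n | graph_free (complete t) G)
               indep_num G].

Local Open Scope ring_scope.
Local Open Scope classical_set_scope.

(* A maximum over the empty family is 0. *)
Definition RT (R : realType) (n : nat) (V : finType) (H : sgraph V) (x : R) :
    nat :=
  (\max_(G : sgraph 'I_n | graph_free H G && ((indep_num G)%:R < x)%R)
     #|edges G|)%N.

Definition RT_density (R : realType) (V : finType) (H : sgraph V)
    (f : nat -> R) : nat -> R :=
  fun n => (RT n H (f n))%:R / n%:R ^+ 2.

Definition rhotau_upper (R : realType) (V : finType) (H : sgraph V)
    (f : nat -> R) : R := limn_sup (RT_density H f).

Definition rhotau_lower (R : realType) (V : finType) (H : sgraph V)
    (f : nat -> R) : R := limn_inf (RT_density H f).

(* The requirement g <= f is imposed for large n only: for g = phi * f with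
   phi tending to 0, it may fail for small n. *)
Definition phase_transition (R : realType) (V : finType) (H : sgraph V)
    (f g : nat -> R) : Prop :=
  (\forall n \near \oo, g n <= f n) /\ rhotau_upper H g < rhotau_lower H f.

Definition phi_phase_transition (R : realType) (V : finType) (H : sgraph V)
    (phi f : nat -> R) : Prop :=
  phase_transition H f (fun n => phi n * f n).

Definition strong_phase_transition (R : realType) (V : finType) (H : sgraph V)
    (f : nat -> R) : Prop :=
  forall phi : nat -> R, (forall n, 0 < phi n) -> phi @ \oo --> (0 : R) ->
    phi_phase_transition H phi f.

Definition Qfun (R : realType) (t : nat) : nat -> R := fun n => (Qmin t n)%:R.
Arguments Qfun : clear implicits.

(* Main.v *)
(** Put r = t - 1 and let l = (s - 1) / r, rounded down.  In a graph with independence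
    number below Q(t,n), the hypothesis on R(t-1,.) makes every set of n^(1-c) vertices
    contain a K_r.  Dependent random choice then turns a positive density of
    K_(l+1) into a K_(r(l+1)), which contains K_s, so the density of a K_s-free graph
    is at most (1 - 1/l)/2; joining l copies of an extremal K_t-free graph shows that
    this value is attained.  The same construction for t + 1 shows that a phase
    transition from Q(t,n) to Q(t+1,n) forces l >= 2 and s <= tl.  If moreover the
    independence number is o(Q(t,n)), every set of linear size contains a K_t.  A graph
    of density near (1 - 1/l)/2 with few copies of K_(l+1) is nearly complete l-partite
    between linear-sized parts, and then contains a K_(tl), hence a K_s; so the density
    drops below (1 - 1/l)/2 by a constant. *)
Require Import Defs.
From mathcomp Require Import all_boot all_order all_algebra.
From mathcomp Require Import all_classical all_reals all_analysis.
From mathcomp Require Import ring lra zify.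

Set Implicit Arguments.
Unset Strict Implicit.
Unset Printing Implicit Defensive.

Import Order.TTheory GRing.Theory Num.Theory.

Local Open Scope nat_scope.

(** * Cliques from dense families of small cliques *)

(** Dependent random choice must destroy up to n^r bad r-tuples, and a bad tuple survives m samples
    with probability exponentially small in m, so m has to be of order log n. The surviving set then
    has size n^(1-c) only, which is why [K_r] is needed in sets of polynomially smaller size and why
    the hypothesis saves a power of n. The saving is in terms of Q(t,n), but n is at most a fixed
    power of Q(t,n).

    Stability is obtained without a regularity or removal lemma: an identity of Goodman with a
    completed square bounds at once the deviation from a complete multipartite graph and the
    variance of the degrees.

    The speed of phi is irrelevant because Q(t,bn) <= bQ(t,n): once phi <= 1/b, phi Q(t,n) is at
    most Q(t,n/b). In the lower bound the obstacle is the strict inequality in the definition of RT: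
    the independence number of the blow-up, a value of Q at about n/l, must be strictly below
    Q(t,n). *)

Definition has_clique (T : finType) (e : rel T) (W : {set T}) (k : nat) : Prop :=
  exists c : seq T, [/\ size c = k, all (fun x => x \in W) c & pairwise e c].

Definition nbhd (T : finType) (e : rel T) (W : {set T}) (v : T) : {set T} :=
  [set u in W | e v u]%SET.

(** Ordered tuples allow a recursion on the first vertex, and for k = 2 they are the arcs. If [e] is
    irreflexive, the entries are distinct. *)
Definition clique_tuples (T : finType) (e : rel T) (W : {set T}) (k : nat) :
    {set k.-tuple T} :=
  [set x : k.-tuple T | all (fun u => u \in W) x && pairwise e x]%SET.

Lemma card_pred_sum (T : finType) (A : {set T}) (P : pred T) :
  #|[set x in A | P x]%SET| = \sum_(x in A) P x.
Proof.
rewrite -sum1_card big_mkcond [RHS]big_mkcond; apply: eq_bigr => x _.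
by rewrite inE; case: (x \in A); case: (P x).
Qed.

Lemma card_set_sum (T : finType) (P : pred T) :
  #|[set x | P x]%SET| = \sum_x P x.
Proof.
rewrite -sum1_card big_mkcond; apply: eq_bigr => x _.
by rewrite inE; case: (P x).
Qed.

Lemma sum_ffun_in (X : finType) (A : {set X}) (m : nat) :
  \sum_(x : {ffun 'I_m -> X}) [forall i, x i \in A] = #|A| ^ m.
Proof.
rewrite -[in RHS](card_ord m) -card_ffun_on -sum1_card [RHS]big_mkcond.
apply: eq_bigr => x _; rewrite unfold_in.
by case: [forall i, _].
Qed.

(** Sample m points of [X] and keep the [v] in [W] whose [L v] contains them all. On average at
    least n / b^(m+1) vertices stay, and a tuple with fewer than |X| / M common points stays with
    probability at most M^(-m). A bad tuple is charged n vertices instead of having one vertex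
    deleted: hence the exponent r + 1 in the hypothesis, and a sample without any bad tuple. *)
Lemma dependent_random_choice (V X : finType) (L : V -> {set X}) (W : {set V})
    (m r b M z : nat) :
  0 < b -> 0 < M -> 0 < z -> 0 < #|X| -> #|V| <= b * #|W| ->
  (forall v, v \in W -> #|X| <= b * #|L v|) ->
  b ^ m.+1 * (M ^ m * z + #|V| ^ r.+1) <= #|V| * M ^ m ->
  exists2 U : {set V}, U \subset W & z <= #|U| /\
    forall a : r.-tuple V, all (fun v => v \in U) a ->
      #|X| <= M * #|[set x | all (fun v => x \in L v) a]%SET|.
Proof.
move=> b0 M0 z0 X0 leW leL hyp.
pose U (x : {ffun 'I_m -> X}) := [set v in W | [forall i, x i \in L v]]%SET.
pose com (a : r.-tuple V) := [set x | all (fun v => x \in L v) a]%SET.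
pose bad x := [set a : r.-tuple V |
  all (fun v => v \in U x) a && (M * #|com a| < #|X|)]%SET.
have [/existsP[x /andP[zU b0x]]|/existsPn no] :=
    boolP [exists x, (z <= #|U x|) && (#|bad x| == 0)].
  exists (U x); first by apply/fintype.subsetP => v; rewrite inE => /andP[].
  split=> // a aU; rewrite leqNgt; apply/negP => lt.
  have : a \in bad x by rewrite inE aU lt.
  by rewrite (cards0_eq (eqP b0x)) inE.
(* Otherwise |U x| < z + n |bad x| for all x, and summing over x contradicts [hyp]. *)
exfalso; set n := #|V| in leW hyp *.
have lt x : #|U x| + 1 <= z + n * #|bad x|.
  have := no x; rewrite negb_and -ltnNge -lt0n addn1 => /orP[ltz|bad0].
    exact: leq_trans ltz (leq_addr _ _).
  rewrite -add1n; apply: leq_add => //.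
  exact: leq_trans (max_card _) (leq_pmulr _ bad0).
have sumU : n * #|X| ^ m <= b ^ m.+1 * \sum_x #|U x|.
  under eq_bigr => x _ do rewrite card_pred_sum.
  rewrite exchange_big /=; under eq_bigr => v _ do rewrite sum_ffun_in.
  rewrite big_distrr /=.
  have : \sum_(v in W) b * #|X| ^ m <= \sum_(v in W) b ^ m.+1 * #|L v| ^ m.
    apply: leq_sum => v /leL le; rewrite expnS -mulnA leq_mul2l -expnMn.
    by rewrite orbC; case: (m) => [|k] //; rewrite leq_exp2r // le.
  by apply: leq_trans; rewrite sum_nat_const mulnA [#|W| * b]mulnC leq_mul2r leW orbT.
have sumB : M ^ m * \sum_x #|bad x| <= n ^ r * #|X| ^ m.
  have le1 : \sum_x #|bad x| <= \sum_(a : r.-tuple V | M * #|com a| < #|X|) #|com a| ^ m.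
    under eq_bigr => x _ do rewrite card_set_sum.
    rewrite exchange_big /= [leqRHS]big_mkcond; apply: leq_sum => a _.
    case: ifP => [lta|_]; last by rewrite big1 // => x _; rewrite andbF.
    rewrite -sum_ffun_in; apply: leq_sum => x _; rewrite andbT.
    case: (boolP (all _ _)) => // /allP aU.
    suff -> : [forall i, x i \in com a] by [].
    apply/forallP => i; rewrite inE; apply/allP => v /aU.
    by rewrite inE => /andP[_ /forallP].
  apply: leq_trans (leq_mul (leqnn _) le1) _; rewrite big_distrr /=.
  rewrite -(card_tuple r V) -sum_nat_const [leqRHS](bigID (fun a => M * #|com a| < #|X|)) /=.
  apply: leq_trans (leq_addr _ _); apply: leq_sum => a lta.
  rewrite -expnMn; case: (m) => [|k] //.
  by rewrite leq_exp2r // ltnW.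
have sumall : \sum_x #|U x| + #|X| ^ m <= #|X| ^ m * z + n * \sum_x #|bad x|.
  have cardF : #|{: {ffun 'I_m -> X}}| = #|X| ^ m by rewrite card_ffun card_ord.
  rewrite -cardF -[X in _ + X <= _]muln1 -[X in _ + X <= _]sum_nat_const.
  rewrite -[X in _ <= X + _]sum_nat_const big_distrr -!big_split /=.
  exact: leq_sum.
have Xm : 0 < #|X| ^ m by rewrite expn_gt0 X0.
have Mm : 0 < M ^ m by rewrite expn_gt0 M0.
have bm : 0 < b ^ m.+1 by rewrite expn_gt0 b0.
move: hyp sumU sumB sumall Xm Mm bm; rewrite (expnS n).
set Y := #|X| ^ m; set B := b ^ m.+1; set A := M ^ m; set P := n ^ r.
set SU := \sum_x _; set SB := \sum_x _ => hyp sU sB sA Y0 A0 B0.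
have h1 : A * (n * Y) <= A * (B * SU) by rewrite leq_mul2l sU orbT.
have h2 : A * B * (SU + Y) <= A * B * (Y * z + n * SB) by rewrite leq_mul2l sA orbT.
have h3 : B * n * (A * SB) <= B * n * (P * Y) by rewrite leq_mul2l sB orbT.
have h4 : Y * (B * (A * z + n * P)) <= Y * (n * A) by rewrite leq_mul2l hyp orbT.
have h5 : 0 < A * B * Y by rewrite !muln_gt0 A0 B0 Y0.
nia.
Qed.

(* Every set of at least n^(1 - 1/p) vertices contains an r-clique; the integer q
   plays the role of n^(1/p), so that no root has to be taken. *)
Definition small_sets_have_clique (T : finType) (e : rel T) (p r : nat) : Prop :=
  forall (S : {set T}) (q : nat), q ^ p <= #|T| -> #|T| <= q * #|S| -> has_clique e S r.

Lemma has_clique_leq (T : finType) (e : rel T) (A : {set T}) (j k : nat) :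
  j <= k -> has_clique e A k -> has_clique e A j.
Proof.
move=> jk [c [sc cA ec]]; exists (take j c).
have sub : subseq (take j c) c by apply: take_subseq.
split; first by rewrite size_takel ?sc.
  by apply/allP => x /(mem_subseq sub) /(allP cA).
exact: subseq_pairwise sub ec.
Qed.

Lemma card_clique_tuples0 (T : finType) (e : rel T) (W : {set T}) :
  #|clique_tuples e W 0| = 1.
Proof.
rewrite (_ : clique_tuples e W 0 = [set: _]%SET) ?cardsT ?card_tuple //.
by apply/setP => x; rewrite !inE (tuple0 x).
Qed.

Lemma card_clique_tuplesS (T : finType) (e : rel T) (W : {set T}) (k : nat) :
  #|clique_tuples e W k.+1| = \sum_(v in W) #|clique_tuples e (nbhd e W v) k|.
Proof.
rewrite {1}/clique_tuples card_set_sum.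
under [RHS]eq_bigr => v _ do rewrite /clique_tuples card_set_sum.
rewrite big_mkcond pair_big_dep /=.
pose h (p : T * k.-tuple T) := [tuple of p.1 :: p.2].
rewrite (reindex h) /=; last first.
  exists (fun x => (thead x, [tuple of behead x])) => [[v x] _|x _].
    by congr (_, _); apply: val_inj.
  by rewrite /h /= [in RHS](tuple_eta x).
rewrite [RHS]big_mkcond /=.
apply: eq_bigr => [[v x]] _ /=; case: (v \in W) => //=.
rewrite andbA -all_predI; congr (_ && _ : nat); apply: eq_all => u /=.
by rewrite inE.
Qed.

Lemma clique_tuples_has_clique (T : finType) (e : rel T) (W : {set T}) (k : nat) :
  0 < #|clique_tuples e W k| -> has_clique e W k.
Proof.
by case/card_gt0P => x; rewrite inE => /andP[xW ex]; exists x; rewrite size_tuple.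
Qed.

(** The sample size m is the logarithm of n to base b^(2p). Then b^m <= n^(1/(2p)), and 3b fits into
    another n^(1/(2p)), so q = 3b^(m+1) is at most n^(1/p). Since 2m >= m + 1, the m-th power of
    b^(4p(r+1)) is at least n^(r+1): the bad tuples cost one vertex, the one subtracted in [z]. *)
Lemma drc_exponent (b p r n : nat) : 1 < b -> 0 < p -> (3 * b) ^ (2 * p) <= n ->
  exists m z q : nat, [/\ 0 < z, q ^ p <= n, n <= q * z &
    b ^ m.+1 * ((b ^ (4 * p * r.+1)) ^ m * z + n ^ r.+1)
      <= n * (b ^ (4 * p * r.+1)) ^ m].
Proof.
move=> b1 p0 leN; have b0 : 0 < b by exact: ltnW.
have n0 : 0 < n by apply: leq_trans leN; rewrite expn_gt0 muln_gt0 b0.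
have B1 : 1 < b ^ (2 * p) by rewrite -{1}(expn0 b) ltn_exp2l ?muln_gt0.
pose m := trunc_log (b ^ (2 * p)) n.
have m0 : 0 < m.
  apply: trunc_log_max => //; rewrite expn1; apply: leq_trans leN.
  by rewrite leq_exp2r ?muln_gt0 ?p0 // leq_pmull.
have lo : b ^ (2 * p * m) <= n by rewrite expnM; exact: trunc_logP.
have hi : n < b ^ (2 * p * m.+1) by rewrite expnM; exact: trunc_log_ltn.
pose Q := b ^ m.+1; pose z := (n %/ Q).-1.
have Q0 : 0 < Q by rewrite expn_gt0 b0.
have qn : (3 * Q) ^ p <= n.
  rewrite -(leq_exp2r _ _ (ltn0Sn 1)) -expnM [p * 2]mulnC.
  rewrite (_ : 3 * Q = (3 * b) * b ^ m); last by rewrite /Q expnS mulnA.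
  by rewrite expnMn -(expnM b) [m * _]mulnC -mulnn leq_mul.
have Qn : 3 * Q <= n.
  by apply: leq_trans qn; rewrite -{1}(expn1 (3 * Q)) leq_pexp2l // muln_gt0 Q0.
have d3 : 3 <= n %/ Q by rewrite leq_divRL.
have zE : z.+1 = n %/ Q by rewrite prednK // (leq_trans _ d3).
have ltn : n < Q * (z.+2) by rewrite mulnC zE ltn_ceil.
have len : Q * z.+1 <= n by rewrite zE mulnC leq_divM.
exists m, z, (3 * Q); split=> //; first by rewrite -ltnS zE (leq_trans _ d3).
  apply: ltnW; apply: leq_trans ltn _; rewrite [3 * Q]mulnC -mulnA leq_mul2l.
  by apply/orP; right; move: d3; rewrite -zE; lia.
rewrite -/Q -expnM; set M := b ^ (4 * _ * _ * _).
have nM : n ^ r.+1 <= M.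
  apply: leq_trans (_ : (b ^ (2 * p * m.+1)) ^ r.+1 <= _).
    by rewrite leq_exp2r // ltnW.
  rewrite -expnM leq_exp2l //.
  rewrite (_ : 4 * p * r.+1 * m = 2 * p * (2 * m) * r.+1); last by ring.
  by rewrite leq_mul2r leq_mul2l; lia.
apply: leq_trans (_ : Q * (M * z.+1) <= _).
  by rewrite leq_mul2l mulnS addnC leq_add2r nM orbT.
by rewrite mulnCA mulnC leq_mul2r len orbT.
Qed.

(** The vertices of weight below N / (2a) carry at most half of the total weight, and each of the
    others carries at most N. *)
Lemma popular_vertices (T : finType) (W : {set T}) (w : T -> nat) (a N : nat) :
  0 < N -> (forall v, w v <= N) -> #|T| * N <= a * \sum_(v in W) w v ->
  #|T| <= 2 * a * #|[set v in W | N <= 2 * a * w v]%SET|.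
Proof.
move=> N0 leN le.
rewrite -(leq_pmul2r N0).
set P := [set v in W | _]%SET.
have sumE : 2 * a * \sum_(v in W) w v <= 2 * a * #|P| * N + #|T| * N.
  have: \sum_(v in W) 2 * a * w v <= \sum_(v : T) (2 * a * N * (v \in P) + N).
    rewrite big_mkcond; apply: leq_sum => v _; rewrite inE.
    case: (v \in W) => //=; case: (leqP N (2 * a * w v)) => h.
      by rewrite muln1 (leq_trans _ (leq_addr _ _)) // leq_mul2l leN orbT.
    by rewrite (leq_trans (ltnW h)) // leq_addl.
  rewrite -big_distrr /= big_split /= sum_nat_const -big_distrr /=.
  suff -> : \sum_i (i \in P) = #|P| by rewrite [2 * a * #|P| * N]mulnAC.
  by rewrite -sum1_card [RHS]big_mkcond.
nia.
Qed.

(* Each step picks an r-clique A whose common neighbourhood still spans a positive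
   proportion of the k-cliques; the choice costs only a power n^(1/p) in the size of
   the set U in which A is sought, because m is logarithmic in n. *)
Lemma dense_cliques (p r k : nat) : 0 < p -> forall a : nat, 0 < a ->
  exists N : nat, forall (T : finType) (e : rel T), N <= #|T| ->
    small_sets_have_clique e p r ->
    forall W : {set T}, #|T| ^ k <= a * #|clique_tuples e W k| ->
      has_clique e W (r * k).
Proof.
move=> p0; elim: k => [|k IH] a a0.
  by exists 0 => T e _ _ W _; exists [::]; rewrite muln0.
(* [b] is the loss of [popular_vertices]; [M] is the loss of the random choice and becomes the new
   [a] in the induction. Neither depends on the graph. *)
pose b := 2 * a; pose M := b ^ (4 * p * r.+1).
have b1 : 1 < b by rewrite /b; lia.
have M0 : 0 < M by rewrite expn_gt0 (ltnW b1).
have [N HN] := IH M M0.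
exists (maxn N ((3 * b) ^ (2 * p))) => T e; rewrite geq_max => /andP[leN len] small W.
have T0 : 0 < #|T| by apply: leq_trans len; rewrite expn_gt0; lia.
rewrite card_clique_tuplesS expnS => dense.
have [r0|r1] := posnP r.
  by exists [::]; rewrite r0.
pose L v := clique_tuples e (nbhd e W v) k.
have X0 : 0 < #|{: k.-tuple T}| by rewrite card_tuple expn_gt0 T0.
have leX v : #|L v| <= #|T| ^ k by rewrite -card_tuple max_card.
have := popular_vertices _ leX dense; rewrite expn_gt0 T0 => /(_ isT) popW.
set W' := [set v in W | _]%SET in popW.
have [m [z [q [z0 qn nqz num]]]] := drc_exponent r b1 p0 len.
have [|U UW' [zU comU]] :=
    dependent_random_choice (ltnW b1) M0 z0 X0 popW _ num (L := L).
  by move=> v; rewrite inE card_tuple => /andP[].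
have [|A [sA AU eA]] := small U q qn.
  by apply: leq_trans nqz _; rewrite leq_mul2l zU orbT.
(* One vertex in [A] is enough to force the tuples common to all [L v] into [W]; for r = 0 there is
   none, hence the separate case. *)
have [v0 v0A] : exists v, v \in A.
  by case: (A) sA => [sA|v A' _]; [rewrite -sA in r1 | exists v; rewrite mem_head].
have sAP : size A == r by apply/eqP.
have := comU (Tuple sAP) AU; rewrite card_tuple /= => comA.
pose WA := [set u in W | all (fun v => e v u) A]%SET.
have [|c [sc cW ec]] := HN T e leN small WA.
  apply: leq_trans comA _; rewrite leq_mul2l; apply/orP; right.
  apply: subset_leq_card; apply/fintype.subsetP => x; rewrite !inE => /allP xA.
  have ux u : u \in x -> u \in WA.
    move=> ux; rewrite inE; apply/andP; split.
      have := xA _ v0A; rewrite inE => /andP[/allP/(_ u ux)].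
      by rewrite inE => /andP[].
    apply/allP => v /xA; rewrite inE => /andP[/allP/(_ u ux)].
    by rewrite inE => /andP[].
  apply/andP; split; first exact/allP.
  by have := xA _ v0A; rewrite inE => /andP[].
exists (A ++ c); split; first by rewrite size_cat sA sc mulnS.
  rewrite all_cat; apply/andP; split.
    by apply: sub_all AU => v /(fintype.subsetP UW'); rewrite inE => /andP[].
  by apply: sub_all cW => v; rewrite inE => /andP[].
rewrite pairwise_cat eA ec !andbT; apply/allrelP => v u vA uc.
by have := allP cW u uc; rewrite inE => /andP[_ /allP/(_ v vA)].
Qed.

(** * Ramsey numbers and extremal independence numbers *)

Lemma graph_of_proof (T : finType) (e : rel T) :
  [forall A in [set [set p.1; p.2]%SET | p in [pred p : T * T | (p.1 != p.2) && e p.1 p.2]]%SET,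
     #|A| == 2].
Proof. by apply/forall_inP => A /imsetP[p /andP[np _] ->]; rewrite cards2 np. Qed.

Definition graph_of (T : finType) (e : rel T) : sgraph T := SGraph (graph_of_proof e).

Lemma adj_graph_of (T : finType) (e : rel T) : symmetric e -> irreflexive e ->
  adj (graph_of e) =2 e.
Proof.
move=> es ei x y; apply/imsetP/idP => [[[u v] /= /andP[/= nuv euv] E]|exy]; last first.
  exists (x, y) => //; rewrite inE /= exy andbT.
  by apply: contraTneq exy => ->; rewrite ei.
have nxy : x != y.
  have : #|[set x; y]%SET| = 2 by rewrite E cards2 nuv.
  by rewrite cards2; case: eqP.
have : x \in [set u; v]%SET by rewrite -E !inE eqxx.
have : y \in [set u; v]%SET by rewrite -E !inE eqxx orbT.
rewrite !inE => /orP[/eqP yu|/eqP yv] /orP[/eqP xu|/eqP xv].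
- by rewrite xu yu eqxx in nxy.
- by rewrite xv yu es.
- by rewrite xu yv.
- by rewrite xv yv eqxx in nxy.
Qed.

Lemma contains_completeP (T : finType) (G : sgraph T) (t : nat) :
  contains (complete t) G <-> has_clique (adj G) [set: T]%SET t.
Proof.
split=> [/existsP[f /andP[/injectiveP finj /forallP fadj]]|[c [sc _ pc]]].
  exists (map f (enum 'I_t)); split; first by rewrite size_map -cardE card_ord.
    by apply/allP => x; rewrite inE.
  rewrite pairwise_map; have := enum_uniq 'I_t; rewrite uniq_pairwise.
  apply: sub_pairwise => i j /= nij.
  by have /forallP/(_ j)/implyP := fadj i; apply; rewrite /adj inE cards2 nij.
have uc : uniq c by apply: pairwise_uniq pc => x; exact: adjxx.
case: t sc => [|t] sc.
  have ff (i : 'I_0) : T by case: i.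
  apply/existsP; exists [ffun i => ff i]; apply/andP; split.
    by apply/injectiveP => - [].
  by apply/forallP => - [].
have x0 : T by case: (c) sc.
apply/existsP; exists [ffun i : 'I_t.+1 => nth x0 c i]; apply/andP; split.
  apply/injectiveP => i j; rewrite !ffunE => /eqP; rewrite nth_uniq ?sc //.
  by move=> /eqP ij; exact: val_inj.
apply/forallP => i; apply/forallP => j; apply/implyP => ij; rewrite !ffunE.
have [lt|lt|eqij] := ltngtP i j.
- by apply: (pairwiseP x0 pc); rewrite ?inE ?sc.
- by rewrite adjC; apply: (pairwiseP x0 pc); rewrite ?inE ?sc.
- by move: ij; rewrite (val_inj eqij) adjxx.
Qed.

Definition indep (T : finType) (e : rel T) (A : {set T}) : Prop :=
  {in A &, forall x y, ~~ e x y}.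

Lemma independentP (T : finType) (G : sgraph T) (A : {set T}) :
  reflect (indep (adj G) A) (independent G A).
Proof.
apply: (iffP forall_inP) => [h x y xA yA|h x xA]; first exact: (forall_inP (h x xA)).
by apply/forall_inP => y yA; exact: h.
Qed.

Lemma indep_num_ge (T : finType) (G : sgraph T) (A : {set T}) :
  indep (adj G) A -> #|A| <= indep_num G.
Proof. by move=> /independentP iA; exact: (@leq_bigmax_cond _ _ (fun A : {set T} => #|A|)). Qed.

Lemma indep_numP (T : finType) (G : sgraph T) :
  exists2 A : {set T}, indep (adj G) A & #|A| = indep_num G.
Proof.
have P0 : 0 < #|[pred A : {set T} | independent G A]|.
  apply/card_gt0P; exists finset.set0; rewrite inE; apply/independentP => x y.
  by rewrite inE.
have [A iA E] := eq_bigmax_cond (fun A : {set T} => #|A|) P0.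
by exists A; [exact/independentP | exact: esym E].
Qed.

Lemma indep_subset (T : finType) (e : rel T) (A B : {set T}) :
  A \subset B -> indep e B -> indep e A.
Proof. by move=> /fintype.subsetP AB iB x y /AB xB /AB yB; exact: iB. Qed.

Lemma subset_of_card (T : finType) (A : {set T}) (m : nat) : m <= #|A| ->
  exists2 B : {set T}, B \subset A & #|B| = m.
Proof.
move=> le; exists [set x in take m (enum A)]%SET.
  by apply/fintype.subsetP => x; rewrite inE => /mem_take; rewrite mem_enum.
rewrite cardsE; apply/eqP; rewrite (card_uniqP _) ?size_takel -?cardE //.
by rewrite take_uniq // enum_uniq.
Qed.

Lemma Qmin_le (t n : nat) (G : sgraph 'I_n) : 1 < t ->
  graph_free (complete t) G -> Qmin t n <= indep_num G.
Proof.
move=> t1 fG; rewrite /Qmin; case: arg_minnP => [|H _ ->//].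
apply/negP => /contains_completeP[[|x [|y c]] [sc _]] //; rewrite -?sc in t1 => //.
by rewrite /= /adj inE.
Qed.

Lemma QminP (t n : nat) : 1 < t ->
  exists2 G : sgraph 'I_n, graph_free (complete t) G & indep_num G = Qmin t n.
Proof.
move=> t1; rewrite /Qmin; case: arg_minnP => [|H fH _]; last by exists H.
apply/negP => /contains_completeP[[|x [|y c]] [sc _]] //; rewrite -?sc in t1 => //.
by rewrite /= /adj inE.
Qed.

(** [Qmin] and [ramsey] speak of graphs on ordinals; this carries n vertices of [S] over to ['I_n],
    and cliques and independent sets back. *)
Lemma pullback_graph (T : finType) (e : rel T) (S : {set T}) (n : nat) :
  symmetric e -> irreflexive e -> n <= #|S| ->
  exists G : sgraph 'I_n,
    (forall t, contains (complete t) G -> has_clique e S t) /\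
    (forall A, independent G A ->
      exists2 B : {set T}, B \subset S & #|B| = #|A| /\ indep e B).
Proof.
move=> es ei nS; pose f (i : 'I_n) := enum_val (widen_ord nS i).
have finj : injective f.
  by move=> i j /enum_val_inj /(congr1 val) /= ij; exact: val_inj.
have fS i : f i \in S by exact: enum_valP.
have gE : adj (graph_of (relpre f e)) =2 relpre f e.
  by apply: adj_graph_of => [i j|i] /=; rewrite ?ei // es.
exists (graph_of (relpre f e)); split=> [t /contains_completeP[c [sc _ pc]]|A /independentP iA].
  exists (map f c); split; first by rewrite size_map.
    by rewrite all_map; apply/allP => i _ /=.
  by rewrite pairwise_map; apply: sub_pairwise pc => i j; rewrite gE.
exists (f @: A)%SET; first by apply/fintype.subsetP => x /imsetP[i _ ->].
split; first by rewrite card_imset.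
by move=> x y /imsetP[i iA' ->] /imsetP[j jA ->]; have := iA i j iA' jA; rewrite gE.
Qed.

Lemma Qmin_indep (T : finType) (e : rel T) (S : {set T}) (t : nat) :
  symmetric e -> irreflexive e -> 1 < t -> ~ has_clique e S t ->
  exists2 A : {set T}, A \subset S & Qmin t #|S| <= #|A| /\ indep e A.
Proof.
move=> es ei t1 nc; have [G [cG iG]] := pullback_graph es ei (leqnn #|S|).
have fG : graph_free (complete t) G by apply/negP => /cG.
have [A iA cA] := indep_numP G.
have [B BS [cB iB]] := iG A (introT (independentP _ _) iA).
by exists B => //; split=> //; rewrite cB cA; exact: Qmin_le.
Qed.

Lemma ramsey_set (T : finType) (e : rel T) (S : {set T}) (t m : nat) :
  symmetric e -> irreflexive e -> ramsey t m <= #|S| ->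
  has_clique e S t \/ exists2 A : {set T}, A \subset S & #|A| = m /\ indep e A.
Proof.
move=> es ei le; have [G [cG iG]] := pullback_graph es ei le.
have : ramsey_prop t m (ramsey t m) by rewrite /ramsey; case: ex_minnP.
move=> /forallP/(_ G)/orP[/cG|/existsP[A /andP[iA /eqP cA]]]; first by left.
by right; have [B BS [cB iB]] := iG A iA; exists B; rewrite // cB cA.
Qed.

Lemma ramsey_le (t m n : nat) :
  (forall G : sgraph 'I_n, has_clique (adj G) [set: 'I_n]%SET t \/
     exists2 A : {set 'I_n}, #|A| = m & indep (adj G) A) ->
  ramsey t m <= n.
Proof.
move=> h; rewrite /ramsey; case: ex_minnP => k _; apply.
apply/forallP => G; apply/orP; case: (h G) => [/contains_completeP|[A cA /independentP iA]].
  by left.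
by right; apply/existsP; exists A; rewrite iA cA eqxx.
Qed.

(** Both sides say that every K_t-free graph on n vertices has an independent set of size m, larger
    ones being trimmed. Through this Galois connection the hypotheses on R act on Q. *)
Lemma leq_Qmin (t m n : nat) : 1 < t -> (m <= Qmin t n) = (ramsey t m <= n).
Proof.
move=> t1; apply/idP/idP => h.
  apply: ramsey_le => G; have [cG|fG] := boolP (contains (complete t) G).
    by left; apply/contains_completeP.
  right; have [A iA cA] := indep_numP G.
  have [|B BA cB] := @subset_of_card _ A m; last by exists B => //; apply: indep_subset iA.
  by rewrite cA (leq_trans h) // Qmin_le.
have [G fG <-] := QminP n t1.
have es : symmetric (adj G) by move=> x y; rewrite adjC.
have ei : irreflexive (adj G) by move=> x; rewrite adjxx.
have hT : ramsey t m <= #|[set: 'I_n]%SET| by rewrite finset.cardsT card_ord.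
have [/contains_completeP|[A _ [<- iA]]] := ramsey_set es ei hT.
  by rewrite (negbTE fG).
exact: indep_num_ge.
Qed.

Lemma leq_Qmin2l (t n n' : nat) : 1 < t -> n <= n' -> Qmin t n <= Qmin t n'.
Proof. by move=> t1 nn'; rewrite leq_Qmin //; apply: leq_trans nn'; rewrite -leq_Qmin. Qed.

Lemma ramsey_gt0 (t m : nat) : 0 < t -> 0 < m -> 0 < ramsey t m.
Proof.
move=> t0 m0; rewrite ltnNge; apply/negP => R0.
have hS : ramsey t m <= #|finset.set0 : {set 'I_0}| by rewrite cards0.
have [[c [sc cS _]]|[A As [cA _]]] :=
    @ramsey_set 'I_0 (fun _ _ => false) _ _ _ (fun _ _ => erefl) (fun _ => erefl) hS.
- by case: c sc cS => [sc|x c _ /=]; [rewrite -sc in t0 | rewrite inE].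
- by move: As; rewrite finset.subset0 => /eqP A0; rewrite -cA A0 cards0 in m0.
Qed.

Lemma ramsey_recursion (t m : nat) : 0 < t ->
  ramsey t.+1 m.+1 <= ramsey t m.+1 + ramsey t.+1 m.
Proof.
move=> t0; apply: ramsey_le; set n := _ + _ => G.
have n0 : 0 < n by rewrite /n addn_gt0 ramsey_gt0.
pose v := Ordinal n0; pose e := adj G.
have es : symmetric e by move=> x y; rewrite /e adjC.
have ei : irreflexive e by move=> x; rewrite /e adjxx.
pose N := nbhd e [set: 'I_n]%SET v; pose M := (~: (v |: N))%SET.
have vN : v \notin N by rewrite !inE ei.
have cNM : (#|N| + #|M|).+1 = n.
  by have := cardsC (v |: N)%SET; rewrite -/M cardsU1 vN card_ord.
have [leN|ltN] := leqP (ramsey t m.+1) #|N|.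
  have [[c [sc cN pc]]|[A AN [cA iA]]] := ramsey_set es ei leN; last by right; exists A.
  left; exists (v :: c); split; first by rewrite /= sc.
    by apply/allP => x; rewrite inE.
  rewrite /= pc andbT; apply: sub_all cN => x.
  by rewrite inE => /andP[].
have leM : ramsey t.+1 m <= #|M| by move: cNM ltN; rewrite /n; lia.
have [[c [sc cM pc]]|[A AM [cA iA]]] := ramsey_set es ei leM.
  by left; exists c; split=> //; apply/allP => x; rewrite inE.
have inM x : x \in A -> (x != v) && ~~ e v x.
  by move=> /(fintype.subsetP AM); rewrite !inE negb_or.
right; exists (v |: A)%SET.
  rewrite cardsU1 cA; case: (boolP (v \in A)) => // /inM.
  by rewrite eqxx.
move=> x y; rewrite !inE => /orP[/eqP->|xA] /orP[/eqP->|yA].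
- by rewrite -/e ei.
- by have /andP[] := inM y yA.
- by rewrite adjC; have /andP[] := inM x xA.
- exact: iA.
Qed.

Lemma ramsey_le_bin (t m : nat) : ramsey t m <= 'C(t + m, t).
Proof.
apply: ramsey_le => G.
have := @ramsey_aux _ G t m [set: _]%SET; rewrite finset.cardsT card_ord.
case=> // [[A _ [cA clA]]|[A _ [cA iA]]]; [left|by right; exists A].
exists (enum A); split; first by rewrite -cardE.
  by apply/allP => x; rewrite inE.
have := enum_uniq A; rewrite uniq_pairwise.
have enA : all (fun x => x \in A) (enum A) by apply/allP => x; rewrite mem_enum.
apply: (@sub_in_pairwise _ (fun x => x \in A)) enA => x y xA yA /= nxy.
exact: clA.
Qed.

(** In b disjoint copies of an extremal graph on n' vertices a clique stays in one copy, and an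
    independent set has at most Q(t,n') vertices in each. *)
Lemma Qmin_mul (t n n' b : nat) : 1 < t -> n <= b * n' -> Qmin t n <= b * Qmin t n'.
Proof.
move=> t1 le; have [H fH <-] := QminP n' t1.
pose e : rel ('I_b * 'I_n') := fun p q => (p.1 == q.1) && adj H p.2 q.2.
have es : symmetric e by move=> p q; rewrite /e eq_sym adjC.
have ei : irreflexive e by move=> p; rewrite /e adjxx andbF.
have nc : ~ has_clique e [set: _]%SET t.
  move=> [c [sc _ pc]]; case/negP: fH; apply/contains_completeP.
  exists (map snd c); split; first by rewrite size_map.
    by apply/allP => x; rewrite inE.
  by rewrite pairwise_map; apply: sub_pairwise pc => p q /andP[].
have [A _ [QA iA]] := Qmin_indep es ei t1 nc.
apply: leq_trans (_ : #|A| <= _).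
  apply: leq_trans QA; apply: leq_Qmin2l => //.
  by rewrite finset.cardsT card_prod !card_ord.
rewrite -sum1_card (partition_big fst xpredT) //=.
rewrite -[b in leqRHS]card_ord -sum_nat_const; apply: leq_sum => i _.
pose Ai := [set p in A | p.1 == i]%SET.
have -> : \sum_(p in A | p.1 == i) 1 = #|Ai|.
  by rewrite -sum1_card; apply: eq_bigl => p; rewrite inE.
have inj : {in Ai &, injective snd}.
  move=> [i1 x1] [i2 x2]; rewrite !inE /= => /andP[_ /eqP->] /andP[_ /eqP->].
  by move=> ->.
rewrite -(card_in_imset inj); apply: indep_num_ge => x y.
move=> /imsetP[p pA ->] /imsetP[q qA ->].
move: pA qA; rewrite !inE => /andP[pA /eqP pi] /andP[qA /eqP qi].
by have := iA p q pA qA; rewrite /e pi qi eqxx.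
Qed.

(** If Q(r+1,n) were at most m, then n < R(r+1,m+1) while R(r+1,m) <= n/l + 1, and the Ramsey
    recursion with the ratio 4 would give (3/4) R(r+1,m+1) <= n/2 + 1, impossible for n > 1. *)
Lemma Qmin_gap (r l M n : nat) : 0 < r -> 1 < l ->
  (forall m, M <= m -> 4 * ramsey r m <= ramsey r.+1 m) ->
  1 < n -> l * ramsey r.+1 M <= n -> Qmin r.+1 (n %/ l).+1 < Qmin r.+1 n.
Proof.
move=> r0 l1 hM n1 hn; rewrite ltnNge; apply/negP; set m := Qmin _ (n %/ l).+1 => le.
have Mm : M <= m.
  rewrite leq_Qmin // (leq_trans _ (leqnSn _)) // leq_divRL; last by lia.
  by rewrite mulnC.
have Rm : ramsey r.+1 m <= (n %/ l).+1 by rewrite -leq_Qmin.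
have nR : n < ramsey r.+1 m.+1 by rewrite ltnNge -leq_Qmin // -ltnNge.
have n2 : n %/ l <= n %/ 2 by apply: leq_div2l.
have := ramsey_recursion m r0; have := hM m.+1 (leqW Mm).
by move: Rm nR n2 n1; lia.
Qed.

Lemma bin_le_exp (n k : nat) : 'C(n, k) <= n ^ k.
Proof.
apply: leq_trans (_ : n ^_ k <= _).
  by rewrite -bin_ffact leq_pmulr // fact_gt0.
rewrite ffact_prod -[k in leqRHS]card_ord -prod_nat_const.
by apply: leq_prod => i _; exact: leq_subr.
Qed.

(** For m = Q(t,n), n < R(t,m+1) <= (t+m+1)^t, and t + m + 1 <= m^2. This converts powers of Q(t,n)
    into powers of n. *)
Lemma vertices_le_Qmin_exp (t n : nat) : 1 < t -> t < Qmin t n ->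
  n <= Qmin t n ^ (2 * t).
Proof.
move=> t1 tm; set m := Qmin t n in tm *.
have lt : n < ramsey t m.+1 by rewrite ltnNge -leq_Qmin // -/m ltnn.
apply: leq_trans (ltnW lt) _; apply: leq_trans (ramsey_le_bin _ _) _.
apply: leq_trans (bin_le_exp _ _) _; rewrite expnM leq_exp2r ?(ltnW t1) //.
by rewrite -mulnn; nia.
Qed.

Lemma sum_card_nbhd (T : finType) (G : sgraph T) :
  \sum_(x in [set: T]%SET) #|nbhd (adj G) [set: T]%SET x| = 2 * #|edges G|.
Proof.
transitivity (\sum_(A in edges G) #|A|); last first.
  rewrite mulnC -sum_nat_const; apply: eq_bigr => A AG.
  exact: eqP (forall_inP (edges_card2 G) A AG).
transitivity (\sum_(A in edges G) \sum_(x : T) (x \in A)); last first.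
  by apply: eq_bigr => A _; rewrite -card_set_sum; apply: eq_card => x; rewrite inE.
rewrite exchange_big /=; apply: eq_big => [x|x _]; first by rewrite inE.
rewrite -card_pred_sum.
rewrite -[LHS](@card_in_imset _ _ (fun y => [set x; y]%SET)).
  apply: eq_card => A; rewrite [RHS]inE; apply/imsetP/andP.
    by move=> [y]; rewrite !inE => /= xy ->; rewrite !inE eqxx.
  move=> [AG xA]; have /cards2P[u [v [uv E]]] := forall_inP (edges_card2 G) A AG.
  move: xA; rewrite E !inE => /orP[/eqP xu|/eqP xv].
    by exists v; rewrite xu // !inE /= /adj -E.
  exists u; last by rewrite xv finset.setUC.
  by rewrite !inE /= /adj xv finset.setUC -E.
move=> y z; rewrite !inE /= => xy xz E.
have : y \in [set x; z]%SET by rewrite -E !inE eqxx orbT.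
by rewrite !inE => /orP[/eqP yx|/eqP//]; rewrite yx adjxx in xy.
Qed.

(** The class of a vertex is its residue modulo l and its position is its quotient; the [.+1] leaves
    room when l does not divide n. A clique has at most r vertices per class, an independent set
    lies in one class, and all non-neighbours of a vertex lie in its own class, whence the error
    term. *)
Lemma turan_blowup (r l s n : nat) (H : sgraph 'I_(n %/ l).+1) :
  0 < l -> r * l < s -> graph_free (complete r.+1) H ->
  exists G : sgraph 'I_n, [/\ graph_free (complete s) G,
    indep_num G <= indep_num H & n * n <= 2 * #|edges G| + n * (n %/ l).+1].
Proof.
move=> l0 rls fH; set m := (n %/ l).+1 in H fH *.
pose pos (x : 'I_n) : 'I_m := inord (x %/ l).
pose cls (x : 'I_n) : 'I_l := Ordinal (ltn_pmod x l0).
have posE x : val (pos x) = x %/ l.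
  by rewrite /= inordK // ltnS leq_div2r // ltnW.
have pos_inj x y : cls x = cls y -> pos x = pos y -> x = y.
  move=> /(congr1 val) /= xy /(congr1 val); rewrite !posE => xy'.
  by apply: val_inj; rewrite /= (divn_eq x l) (divn_eq y l) xy xy'.
pose e x y := (cls x == cls y) ==> adj H (pos x) (pos y).
have es : symmetric e by move=> x y; rewrite /e eq_sym adjC.
have ei : irreflexive e by move=> x; rewrite /e eqxx adjxx.
have eE := adj_graph_of es ei.
exists (graph_of e); split.
- apply/negP => /contains_completeP[c [sc _ pc]].
  have {}pc : pairwise e c by apply: sub_pairwise pc => x y; rewrite eE.
  have : size c <= r * l; last by rewrite sc leqNgt rls.
  rewrite -(count_predT c) -sum1_count.
  rewrite (partition_big cls xpredT) //= mulnC -[l in leqRHS]card_ord -sum_nat_const.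
  apply: leq_sum => i _; rewrite sum1_count -size_filter leqNgt; apply/negP => lt.
  case/negP: fH; apply/contains_completeP; apply: has_clique_leq lt _.
  exists (map pos [seq x <- c | cls x == i]); split; first by rewrite size_map.
    by apply/allP => x; rewrite inE.
  rewrite pairwise_map; have := pairwise_filter (fun x => cls x == i) pc.
  apply: (@sub_in_pairwise _ (fun x => cls x == i)); last exact: filter_all.
  by move=> x y /eqP xi /eqP yi; rewrite /e xi yi eqxx.
- have [A iA <-] := indep_numP (graph_of e).
  have cA x y : x \in A -> y \in A -> cls x = cls y /\ ~~ adj H (pos x) (pos y).
    by move=> xA yA; have := iA x y xA yA; rewrite eE /e negb_imply => /andP[/eqP].
  rewrite -(@card_in_imset _ _ pos A); last first.
    by move=> x y xA yA; apply: pos_inj; have [] := cA x y xA yA.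
  apply: indep_num_ge => _ _ /imsetP[x xA ->] /imsetP[y yA ->].
  by have [] := cA x y xA yA.
rewrite -sum_card_nbhd.
have card_n : #|[set: 'I_n]%SET| = n by rewrite finset.cardsT card_ord.
suff : \sum_(x in [set: 'I_n]%SET) n <=
    \sum_(x in [set: 'I_n]%SET) (#|nbhd (adj (graph_of e)) [set: 'I_n]%SET x| + m).
  by rewrite sum_nat_const big_split /= sum_nat_const card_n.
apply: leq_sum => x _.
have := cardsC (nbhd (adj (graph_of e)) [set: 'I_n]%SET x).
rewrite card_ord => {1}<-; rewrite leq_add2l.
rewrite -[m]card_ord -(@card_in_imset _ _ pos); first exact: max_card.
move=> y z; rewrite !inE !eE /= !negb_imply => /andP[/eqP xy _] /andP[/eqP xz _].
by apply: pos_inj; rewrite -xy -xz.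
Qed.

Lemma RT_ge (R : realType) (n : nat) (V : finType) (H : sgraph V) (x : R) (G : sgraph 'I_n) :
  graph_free H G -> ((indep_num G)%:R < x)%R -> #|edges G| <= RT n H x.
Proof.
move=> fG ltx; apply: (@leq_bigmax_cond _ _ (fun G : sgraph 'I_n => #|edges G|)).
by rewrite fG ltx.
Qed.

Local Open Scope ring_scope.

(** * Supersaturation and stability *)

(** Ordered pairs: for a graph, twice the edges, so the density (1 - 1/l)/2 reads 1 - 1/l. *)
Definition arcs (R : realType) (T : finType) (e : rel T) (W : {set T}) : R :=
  \sum_(x in W) \sum_(y in W) (e x y)%:R.

Definition deg (R : realType) (T : finType) (e : rel T) (W : {set T}) (v : T) : R :=
  #|nbhd e W v|%:R.

(* Twice the number of pairs of an edge and a vertex adjacent to neither end; it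
   vanishes exactly when non-adjacency is transitive. *)
Definition far_arcs (R : realType) (T : finType) (e : rel T) (W : {set T}) : R :=
  \sum_(z in W) \sum_(x in W) \sum_(y in W)
    (e x y)%:R * (1 - (e z x)%:R) * (1 - (e z y)%:R).

Lemma sumr_in_nbhd (R : realType) (T : finType) (e : rel T) (W : {set T}) (v : T)
    (F : T -> R) :
  \sum_(x in nbhd e W v) F x = \sum_(x in W) (e v x)%:R * F x.
Proof.
rewrite big_mkcond [RHS]big_mkcond; apply: eq_bigr => x _; rewrite inE.
by case: (x \in W); case: (e v x); rewrite ?mul1r ?mul0r.
Qed.

Lemma degE (R : realType) (T : finType) (e : rel T) (W : {set T}) (v : T) :
  deg R e W v = \sum_(u in W) (e v u)%:R.
Proof. by rewrite /deg /nbhd card_pred_sum natr_sum. Qed.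

Lemma sumr_const_in (R : realType) (T : finType) (W : {set T}) (c : R) :
  \sum_(x in W) c = #|W|%:R * c.
Proof. by rewrite sumr_const mulr_natl. Qed.

Lemma sum_deg (R : realType) (T : finType) (e : rel T) (W : {set T}) :
  \sum_(v in W) deg R e W v = arcs R e W.
Proof. by apply: eq_bigr => v _; rewrite degE. Qed.

Lemma arcs_le (R : realType) (T : finType) (e : rel T) (W : {set T}) :
  arcs R e W <= #|W|%:R ^+ 2.
Proof.
rewrite expr2 -sumr_const_in; apply: ler_sum => x _.
rewrite -[#|W|%:R]mulr1 -sumr_const_in; apply: ler_sum => y _.
by rewrite lern1 leq_b1.
Qed.

Lemma far_arcs_ge0 (R : realType) (T : finType) (e : rel T) (W : {set T}) :
  0 <= far_arcs R e W.
Proof.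
do 3![apply: sumr_ge0 => ? _].
by case: (e _ _); case: (e _ _); case: (e _ _) => /=; lra.
Qed.

(** Expand the product. By symmetry both mixed terms count walks of length two, that is squared
    degrees, and the triple product counts arcs inside neighbourhoods. *)
Lemma far_arcsE (R : realType) (T : finType) (e : rel T) (W : {set T}) :
  symmetric e ->
  far_arcs R e W = #|W|%:R * arcs R e W - 2 * \sum_(v in W) deg R e W v ^+ 2
    + \sum_(v in W) arcs R e (nbhd e W v).
Proof.
move=> es.
pose I x y : R := (e x y)%:R.
have IC x y : I x y = I y x by rewrite /I es.
have sumz z : \sum_(x in W) \sum_(y in W) I x y * (1 - I z x) * (1 - I z y) =
    arcs R e W - 2 * (\sum_(x in W) I z x * deg R e W x) + arcs R e (nbhd e W z).
  have -> : arcs R e (nbhd e W z) = \sum_(x in W) \sum_(y in W) I z x * (I z y * I x y).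
    rewrite /arcs sumr_in_nbhd; apply: eq_bigr => x _.
    by rewrite sumr_in_nbhd big_distrr.
  have E1 : \sum_(x in W) I z x * deg R e W x = \sum_(x in W) \sum_(y in W) I z x * I x y.
    by apply: eq_bigr => x _; rewrite degE big_distrr.
  have E2 : \sum_(x in W) I z x * deg R e W x = \sum_(x in W) \sum_(y in W) I z y * I x y.
    rewrite E1 exchange_big; apply: eq_bigr => x _; apply: eq_bigr => y _.
    by rewrite [I y x]IC.
  transitivity (arcs R e W - \sum_(x in W) \sum_(y in W) I z x * I x y
      - \sum_(x in W) \sum_(y in W) I z y * I x y
      + \sum_(x in W) \sum_(y in W) I z x * (I z y * I x y)).
    rewrite -!sumrB -big_split /=; apply: eq_bigr => x _.
    by rewrite -!sumrB -big_split /=; apply: eq_bigr => y _; rewrite /I; ring.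
  by rewrite -E1 -E2; ring.
rewrite /far_arcs; under eq_bigr => z _ do rewrite sumz.
rewrite big_split sumrB /= sumr_const_in -big_distrr /=; congr (_ - _ * _ + _).
rewrite exchange_big; apply: eq_bigr => x _ /=; rewrite -big_distrl /= expr2.
by congr (_ * _); rewrite degE; apply: eq_bigr => z _; rewrite IC.
Qed.

(* Goodman's identity [far_arcsE] with the square completed at the degree of the
   vertices of a Turan graph with l + 1 parts. *)
Lemma far_arcs_variance (R : realType) (T : finType) (e : rel T) (W : {set T}) (l : R) :
  symmetric e -> 0 < l ->
  far_arcs R e W
    + (1 + l^-1) * \sum_(v in W) (deg R e W v - l / (l + 1) * #|W|%:R) ^+ 2 =
  \sum_(v in W) (arcs R e (nbhd e W v) - (1 - l^-1) * deg R e W v ^+ 2)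
    - #|W|%:R * (arcs R e W - l / (l + 1) * #|W|%:R ^+ 2).
Proof.
move=> es l0; rewrite far_arcsE // sumrB -big_distrr /=.
set w : R := #|W|%:R; set mu := l / (l + 1) * w.
have -> : \sum_(v in W) (deg R e W v - mu) ^+ 2 =
    \sum_(v in W) deg R e W v ^+ 2 - 2 * mu * arcs R e W + w * mu ^+ 2.
  rewrite -sum_deg -sumr_const_in big_distrr -sumrB -big_split /=.
  by apply: eq_bigr => v _; ring.
set A := \sum_(v in W) arcs _ _ _; set S := \sum_(v in W) _ ^+ 2.
rewrite /mu; field; lra.
Qed.

(** Vertices outside the set on the right contribute less than eps n^2 each, the others at most n^2.
    With a = 1 - 1/l the set collects the vertices whose neighbourhood exceeds the Turan density for
    l parts. *)
Lemma sum_dense_nbhds (R : realType) (T : finType) (e : rel T) (W : {set T}) (a eps : R) :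
  0 <= a -> 0 <= eps ->
  \sum_(v in W) (arcs R e (nbhd e W v) - a * deg R e W v ^+ 2) <=
  eps * #|T|%:R ^+ 2 * #|W|%:R + #|T|%:R ^+ 2 *
    #|[set v in W | a * deg R e W v ^+ 2 + eps * #|T|%:R ^+ 2 <= arcs R e (nbhd e W v)]%SET|%:R.
Proof.
move=> a0 eps0; rewrite card_pred_sum natr_sum big_distrr /= [eps * _ * _]mulrC.
rewrite -sumr_const_in -big_split /=; apply: ler_sum => v _.
have n0 : 0 <= #|T|%:R ^+ 2 :> R by apply: exprn_ge0.
have en0 := mulr_ge0 eps0 n0.
have d0 : 0 <= a * deg R e W v ^+ 2 by rewrite mulr_ge0 // sqr_ge0.
case: (leP (a * deg R e W v ^+ 2 + _) (arcs R e (nbhd e W v))) => [h|h]; last first.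
  by rewrite /= mulr0; lra.
have : arcs R e (nbhd e W v) <= #|T|%:R ^+ 2.
  by apply: le_trans (arcs_le _ _ _) _; rewrite lerXn2r ?nnegrE // ler_nat max_card.
by rewrite /= mulr1; lra.
Qed.

Lemma supersaturation_step (R : realType) (T : finType) (e : rel T) (W V : {set T})
    (k : nat) (c : R) :
  V \subset W ->
  (forall v, v \in V -> c * #|T|%:R ^+ k <= #|clique_tuples e (nbhd e W v) k|%:R) ->
  c * #|V|%:R * #|T|%:R ^+ k <= #|clique_tuples e W k.+1|%:R.
Proof.
move=> VW dense; rewrite card_clique_tuplesS natr_sum.
rewrite (finset.big_setID V) /= (finset.setIidPr VW) -[leLHS]addr0 lerD //; last exact: sumr_ge0.
by rewrite [c * _]mulrC -mulrA -sumr_const_in; exact: ler_sum.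
Qed.

(** Dropping the two non-negative terms on the left of [far_arcs_variance] leaves an average excess
    of the neighbourhoods over the Turan density with one part fewer. The excess is measured against
    all of [T], so that the induction hypothesis applies inside a neighbourhood. *)
Lemma supersaturation (R : realType) (l : nat) (eps : R) : 0 < eps ->
  exists2 c : R, 0 < c & forall (T : finType) (e : rel T) (W : {set T}), symmetric e ->
    (1 - l.+1%:R^-1) * #|W|%:R ^+ 2 + eps * #|T|%:R ^+ 2 <= arcs R e W ->
    c * #|T|%:R ^+ l.+2 <= #|clique_tuples e W l.+2|%:R.
Proof.
elim: l eps => [|l IH] eps eps0.
  exists eps => // T e W _; rewrite invr1 subrr mul0r add0r => h.
  apply: le_trans h _; rewrite card_clique_tuplesS natr_sum.
  rewrite -sum_deg le_eqVlt; apply/orP; left; apply/eqP; apply: eq_bigr => v _.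
  rewrite card_clique_tuplesS; congr (_%:R).
  under eq_bigr => u _ do rewrite card_clique_tuples0.
  by rewrite sum1_card.
(* The density forces |W| >= eps n, so the total excess is at least eps^2 n^3: one half is allowed
   as excess eps^2/2 per vertex, the other half bounds the number of dense neighbourhoods. *)
have eps'0 : 0 < eps ^+ 2 / 2 by rewrite divr_gt0 // exprn_gt0.
have [c c0 Hc] := IH _ eps'0.
exists (c * (eps ^+ 2 / 2)); first exact: mulr_gt0.
move=> T e W es dense.
set n : R := #|T|%:R; set w : R := #|W|%:R in dense *.
have [n0|n0] := posnP #|T|.
  by rewrite /n n0 expr0n /= mulr0.
have n1 : 0 < n by rewrite ltr0n.
pose l1 : R := l.+1%:R.
have l0 : 0 < l1 by rewrite ltr0n.
have w0 : 0 <= w by exact: ler0n.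
have wn : w <= n by rewrite ler_nat max_card.
have l2E : (1 - l.+2%:R^-1 : R) = l1 / (l1 + 1).
  by rewrite (_ : l.+2%:R = l1 + 1) ?[RHS]natr1 //; field; lra.
have li : 0 <= 1 - l1^-1 by rewrite subr_ge0 invf_le1 // ler1n.
have lii : 0 <= 1 + l1^-1 by rewrite addr_ge0 // invr_ge0 ltW.
have := sum_dense_nbhds e W li (ltW eps'0).
set V := [set v in W | _]%SET => sumV.
have VW : V \subset W by apply/fintype.subsetP => v; rewrite inE => /andP[].
have := far_arcs_variance W es l0; rewrite -/w => var.
have far0 := far_arcs_ge0 R e W.
have var0 : 0 <= (1 + l1^-1) * \sum_(v in W) (deg R e W v - l1 / (l1 + 1) * w) ^+ 2.
  by apply: mulr_ge0 => //; apply: sumr_ge0 => v _; exact: sqr_ge0.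
rewrite l2E in dense.
have wen : eps * n <= w.
  have : eps * n ^+ 2 <= w ^+ 2.
    apply: le_trans (arcs_le R e W); apply: le_trans dense.
    by rewrite lerDr mulr_ge0 ?sqr_ge0 // divr_ge0 ?addr_ge0 // ltW.
  nra.
have Vbig : eps ^+ 2 / 2 * n <= #|V|%:R.
  have n2 : 0 < n ^+ 2 by rewrite exprn_gt0.
  rewrite -(ler_pM2l n2).
  have h1 : eps ^+ 2 * n ^+ 3 <= w * (eps * n ^+ 2).
    have -> : eps ^+ 2 * n ^+ 3 = eps * n * (eps * n ^+ 2) by ring.
    by rewrite ler_wpM2r // mulr_ge0 // ltW.
  have h2 : w * (eps * n ^+ 2) <= w * (arcs R e W - l1 / (l1 + 1) * w ^+ 2).
    by apply: ler_wpM2l => //; lra.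
  have h3 : eps ^+ 2 / 2 * n ^+ 2 * w <= eps ^+ 2 / 2 * n ^+ 2 * n.
    by apply: ler_wpM2l => //; rewrite mulr_ge0 // ltW.
  rewrite -/n -/w in sumV.
  have -> : n ^+ 2 * (eps ^+ 2 / 2 * n) = eps ^+ 2 * n ^+ 3 - eps ^+ 2 / 2 * n ^+ 2 * n by field.
  move: sumV var h1 h2 h3 far0 var0; set p1 := (1 + _) * _.
  set S := \sum_(v in W) _; set Q := w * (_ - _); set F := far_arcs R e W.
  by move=> *; lra.
have := @supersaturation_step R T e W V l.+2 c VW.
have h v : v \in V -> c * #|T|%:R ^+ l.+2 <= #|clique_tuples e (nbhd e W v) l.+2|%:R.
  by rewrite inE => /andP[_ dv]; apply: Hc.
move=> /(_ h); apply: le_trans; rewrite -/n exprS.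
have -> : c * (eps ^+ 2 / 2) * (n * n ^+ l.+2) = c * (eps ^+ 2 / 2 * n) * n ^+ l.+2 by ring.
by rewrite ler_wpM2r ?exprn_ge0 ?(ltW n1) // ler_wpM2l // ltW.
Qed.

Lemma clique_density_blowup (R : realType) (p r k : nat) (c : R) : (0 < p)%N -> 0 < c ->
  exists N : nat, forall (T : finType) (e : rel T), (N <= #|T|)%N ->
    small_sets_have_clique e p r ->
    forall W : {set T}, c * #|T|%:R ^+ k <= #|clique_tuples e W k|%:R ->
      has_clique e W (r * k).
Proof.
move=> p0 c0.
have ci0 : 0 <= c^-1 by rewrite invr_ge0 ltW.
have ca := archi_boundP ci0; set a := Num.bound _ in ca.
have a0 : (0 < a)%N by rewrite -(ltr0n R) (le_lt_trans ci0).
have [N HN] := dense_cliques r k p0 a0.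
exists N => T e leN small W dense; apply: HN => //.
rewrite -(ler_nat R) natrM natrX.
apply: le_trans (_ : a%:R * (c * #|T|%:R ^+ k) <= _); last by rewrite ler_wpM2l.
rewrite mulrA -[leLHS]mul1r ler_wpM2r ?exprn_ge0 //.
by rewrite -(ler_pM2r (x := c^-1)) ?invr_gt0 // mul1r mulfK ?gt_eqF // ltW.
Qed.

Lemma dense_graph_clique (R : realType) (p r l : nat) (eps : R) : (0 < p)%N -> 0 < eps ->
  exists N : nat, forall (T : finType) (e : rel T), symmetric e -> (N <= #|T|)%N ->
    small_sets_have_clique e p r ->
    (1 - l.+1%:R^-1 + eps) * #|T|%:R ^+ 2 <= arcs R e [set: T]%SET ->
    has_clique e [set: T]%SET (r * l.+2).
Proof.
move=> p0 eps0; have [c c0 Hc] := supersaturation l eps0.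
have [N HN] := clique_density_blowup r l.+2 p0 c0.
exists N => T e es leN small dense; apply: HN => //; apply: Hc => //.
by rewrite finset.cardsT -mulrDl.
Qed.

(** * Nearly complete multipartite graphs *)

Definition nonarcs (R : realType) (T : finType) (e : rel T) (U W : {set T}) : R :=
  \sum_(u in U) \sum_(w in W) (~~ e u w)%:R.

Lemma nonarcs_subset (R : realType) (T : finType) (e : rel T) (U U' W W' : {set T}) :
  U' \subset U -> W' \subset W -> nonarcs R e U' W' <= nonarcs R e U W.
Proof.
move=> UU' WW'; rewrite /nonarcs [leRHS](finset.big_setID U') /= (finset.setIidPr UU').
rewrite -[leLHS]addr0 lerD //; last by do 2![apply: sumr_ge0 => ? _].
apply: ler_sum => u _; rewrite [leRHS](finset.big_setID W') /= (finset.setIidPr WW').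
by rewrite lerDl; apply: sumr_ge0.
Qed.

(** Greedy choice: discard from the first part the vertices with many non-neighbours in some later
    part, take a [K_t] in the rest, and cut the later parts down to its common neighbourhood. They
    keep (beta/2) n vertices, and the bound on non-arcs passes to subsets. Disjoint parts are not
    assumed, as the parts will be co-neighbourhoods. *)
Lemma multipartite_embedding (R : realType) (t k : nat) (beta : R) : 0 < beta ->
  exists gamma beta' : R, [/\ 0 < gamma, 0 < beta' &
    forall (T : finType) (e : rel T), (0 < #|T|)%N ->
    (forall S : {set T}, beta' * #|T|%:R <= #|S|%:R -> has_clique e S t) ->
    forall Us : seq {set T}, size Us = k ->
      all (fun U : {set T} => beta * #|T|%:R <= #|U|%:R) Us ->
      pairwise (fun U W => nonarcs R e U W <= gamma * #|T|%:R ^+ 2) Us ->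
      has_clique e [set x | has (fun U : {set T} => x \in U) Us]%SET (t * k)].
Proof.
elim: k beta => [|k IH] beta beta0.
  exists 1, 1; split=> // T e _ _ Us _ _ _.
  by exists [::]; rewrite muln0.
have beta20 : 0 < beta / 2 by lra.
have [gamma1 [beta1 [gamma10 beta10 emb]]] := IH _ beta20.
(* The t clique vertices remove at most t delta n <= (beta/2) n vertices from a later part; [+ 1]
   covers t = 0. *)
pose delta := beta / (2 * (t%:R + 1)).
have t0 : 0 <= t%:R :> R by exact: ler0n.
have k0 : 0 <= k%:R :> R by exact: ler0n.
have delta0 : 0 < delta by apply: divr_gt0 => //; lra.
have tdelta : t%:R * delta <= beta / 2.
  rewrite /delta mulrA; move: t%:R t0 => x x0; rewrite ler_pdivrMr; last by lra.
  by rewrite (_ : _ / 2 * _ = x * beta + beta); [lra|field].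
(* Counting non-arcs, at most k gamma2 n / delta <= (beta/2) n vertices of the first part are
   discarded. *)
pose gamma2 := beta * delta / (2 * (k%:R + 1)).
have gamma20 : 0 < gamma2 by apply: divr_gt0; [exact: mulr_gt0|lra].
have kgamma : k%:R * gamma2 <= delta * (beta / 2).
  have db : 0 < beta * delta by exact: mulr_gt0.
  rewrite /gamma2 mulrA; move: k%:R k0 => x x0; rewrite ler_pdivrMr; last by lra.
  rewrite (_ : delta * (beta / 2) * _ = x * (beta * delta) + beta * delta).
    by lra.
  by field.
exists (Num.min gamma1 gamma2), (Num.min beta1 (beta / 2)); split.
- by rewrite lt_min gamma10.
- by rewrite lt_min beta10.
move=> T e T0 lin [|U Us] // [sU] /= /andP[bU bUs] /andP[gU gUs].
set n : R := #|T|%:R in lin bU bUs gU gUs.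
have n0 : 0 < n by rewrite ltr0n.
pose nn u (W : {set T}) : R := \sum_(w in W) (~~ e u w)%:R.
pose B := [set u in U | has (fun W => delta * n < nn u W) Us]%SET.
have nn0 u W : 0 <= nn u W by apply: sumr_ge0.
have BU : B \subset U by apply/fintype.subsetP => u; rewrite inE => /andP[].
have cardB : #|B|%:R <= beta / 2 * n.
  have h1 : #|B|%:R * (delta * n) <= \sum_(u in B) \sum_(W <- Us) nn u W.
    rewrite -sumr_const_in; apply: ler_sum => u; rewrite inE => /andP[_ /hasP[W WUs]].
    move=> /ltW lt; apply: le_trans lt _.
    by rewrite (big_rem W) //= lerDl; apply: sumr_ge0.
  have h2 : \sum_(u in B) \sum_(W <- Us) nn u W <= k%:R * (gamma2 * n ^+ 2).
    rewrite exchange_big /=.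
    have -> : k%:R * (gamma2 * n ^+ 2) = \sum_(W <- Us) gamma2 * n ^+ 2.
      by rewrite big_const_seq count_predT sU iter_addr_0 mulr_natl.
    rewrite big_seq [leRHS]big_seq; apply: ler_sum => W WUs.
    apply: le_trans (nonarcs_subset R e BU (subxx W)) _.
    apply: le_trans (allP gU W WUs) _.
    by rewrite ler_wpM2r ?exprn_ge0 ?(ltW n0) // ge_min lexx orbT.
  rewrite -(ler_pM2r (x := delta * n)) ?mulr_gt0 //; apply: le_trans h1 _.
  apply: le_trans h2 _; rewrite mulrA.
  have -> : beta / 2 * n * (delta * n) = delta * (beta / 2) * n ^+ 2 by ring.
  by rewrite ler_wpM2r // exprn_ge0 // ltW.
have [|c [sc cU ec]] := lin (U :\: B)%SET.
  have cUB : #|U|%:R = #|B|%:R + #|(U :\: B)%SET|%:R :> R.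
    by rewrite -natrD -(cardsID B U) (finset.setIidPr BU).
  have : Num.min beta1 (beta / 2) * n <= beta / 2 * n.
    by rewrite ler_wpM2r ?(ltW n0) // ge_min lexx orbT.
  lra.
pose cut (W : {set T}) := [set w in W | all (fun u => e u w) c]%SET.
have cutW W : cut W \subset W by apply/fintype.subsetP => w; rewrite inE => /andP[].
have [||||c' [sc' cW ec']] := emb T e T0 _ (map cut Us).
- move=> S hS; apply: lin; apply: le_trans hS.
  by rewrite ler_wpM2r ?(ltW n0) // ge_min lexx.
- by rewrite size_map.
- rewrite all_map; apply/allP => W WUs /=; rewrite -/n.
  have h1 : #|W|%:R <= #|cut W|%:R + \sum_(u <- c) nn u W.
    rewrite exchange_big /= card_pred_sum natr_sum -big_split /= -sum1_card natr_sum.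
    apply: ler_sum => w wW; case: (boolP (all _ c)) => [_|].
      by rewrite lerDl; apply: sumr_ge0.
    move=> /allPn[u uc neu]; rewrite add0r (big_rem u) //= neu lerDl.
    by apply: sumr_ge0.
  have h2 : \sum_(u <- c) nn u W <= t%:R * (delta * n).
    have -> : t%:R * (delta * n) = \sum_(u <- c) delta * n.
      by rewrite big_const_seq count_predT sc iter_addr_0 mulr_natl.
    rewrite big_seq [leRHS]big_seq; apply: ler_sum => u uc.
    have := allP cU u uc; rewrite !inE => /andP[+ uU].
    by rewrite uU /= => /hasPn/(_ W WUs); rewrite -leNgt.
  have h3 := allP bUs W WUs.
  have h4 : t%:R * (delta * n) <= beta / 2 * n by rewrite mulrA ler_wpM2r // ltW.
  lra.
- rewrite pairwise_map; apply: sub_pairwise gUs => W W' /= h.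
  apply: le_trans (nonarcs_subset R e (cutW W) (cutW W')) _; apply: le_trans h _.
  by rewrite ler_wpM2r ?exprn_ge0 ?(ltW n0) // ge_min lexx.
exists (c ++ c'); split; first by rewrite size_cat sc sc' mulnS.
  rewrite all_cat; apply/andP; split.
    by apply: sub_all cU => u; rewrite !inE /= => /andP[_ ->].
  apply: sub_all cW => u; rewrite !inE has_map => /hasP[W WUs] /= uW.
  by apply/orP; right; apply/hasP; exists W => //; apply: fintype.subsetP uW.
rewrite pairwise_cat ec ec' !andbT; apply/allrelP => u w uc wc'.
have := allP cW w wc'; rewrite inE has_map => /hasP[W WUs] /=.
by rewrite inE => /andP[_ /allP]; apply.
Qed.

(** In a complete multipartite graph this is the part containing [v]. *)
Definition conbhd (T : finType) (e : rel T) (v : T) : {set T} := [set u | ~~ e v u]%SET.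

Lemma sumr_in_setT (R : realType) (T : finType) (F : T -> R) :
  \sum_(x in [set: T]%SET) F x = \sum_x F x.
Proof. by apply: eq_bigl => x; rewrite inE. Qed.

Lemma sumr_in_set (R : realType) (T : finType) (P : pred T) (F : T -> R) :
  \sum_(x in [set y | P y]%SET) F x = \sum_x (P x)%:R * F x.
Proof.
rewrite big_mkcond; apply: eq_bigr => x _; rewrite inE.
by case: (P x); rewrite ?mul1r ?mul0r.
Qed.

Lemma nonarcsC (R : realType) (T : finType) (e : rel T) (U W : {set T}) :
  symmetric e -> nonarcs R e U W = nonarcs R e W U.
Proof.
move=> es; rewrite /nonarcs exchange_big; apply: eq_bigr => x _.
by apply: eq_bigr => y _; rewrite es.
Qed.

(** Let xy be an arc, u not adjacent to x, and w adjacent neither to y nor to u. If w is not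
    adjacent to x, then w is far from xy; otherwise u is far from xw. Either way one of the four
    vertices is free, whence the factor n twice. *)
Lemma sum_nonarcs_conbhd (R : realType) (T : finType) (e : rel T) : symmetric e ->
  \sum_x \sum_y (e x y)%:R * nonarcs R e (conbhd e x) (conbhd e y) <=
    2 * #|T|%:R * far_arcs R e [set: T]%SET.
Proof.
move=> es; set n : R := #|T|%:R.
pose F z x y : R := (e x y)%:R * (1 - (e z x)%:R) * (1 - (e z y)%:R).
have farE : far_arcs R e [set: T]%SET = \sum_z \sum_x \sum_y F z x y.
  rewrite /far_arcs sumr_in_setT; apply: eq_bigr => z _.
  by rewrite sumr_in_setT; apply: eq_bigr => x _; rewrite sumr_in_setT.
have sumc (c : R) : \sum_(x : T) c = n * c by rewrite sumr_const mulr_natl.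
apply: le_trans (_ : \sum_x \sum_y \sum_u \sum_w (F u x w + F w x y) <= _).
  apply: ler_sum => x _; apply: ler_sum => y _.
  rewrite /nonarcs sumr_in_set big_distrr; apply: ler_sum => u _ /=.
  rewrite sumr_in_set !big_distrr; apply: ler_sum => w _ /=.
  rewrite /F (es x u) (es y w) (es x w).
  by case: (e x y); case: (e u x); case: (e w y); case: (e u w); case: (e w x) => /=; lra.
have -> : 2 * n * far_arcs R e [set: T]%SET =
    n * far_arcs R e [set: T]%SET + n * far_arcs R e [set: T]%SET by ring.
under eq_bigr => x _ do under eq_bigr => y _ do under eq_bigr => u _ do rewrite big_split /=.
under eq_bigr => x _ do under eq_bigr => y _ do rewrite big_split /=.
under eq_bigr => x _ do rewrite big_split /=.
rewrite big_split /= lerD //.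
  under eq_bigr => x _ do rewrite sumc.
  by rewrite -big_distrr /= exchange_big farE.
under eq_bigr => x _ do under eq_bigr => y _ do rewrite sumc.
under eq_bigr => x _ do rewrite -big_distrr /=.
rewrite -big_distrr /= farE.
under eq_bigr => x _ do rewrite exchange_big /=.
by rewrite exchange_big.
Qed.

Lemma degree_le_conbhd (R : realType) (T : finType) (e : rel T) (v : T) :
  #|conbhd e v|%:R = #|T|%:R - deg R e [set: T]%SET v.
Proof.
have -> : conbhd e v = (~: nbhd e [set: T] v)%SET.
  by apply/finset.setP => u; rewrite !inE.
by rewrite /deg -(cardsC (nbhd e [set: T]%SET v)) natrD addrC addKr.
Qed.

(** Chebyshev's inequality for the upper tail. *)
Lemma card_deviating (R : realType) (T : finType) (e : rel T) (mu d S : R) : 0 < d ->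
  \sum_(v in [set: T]%SET) (deg R e [set: T]%SET v - mu) ^+ 2 <= S ->
  #|[set v | mu + d < deg R e [set: T]%SET v]%SET|%:R * d ^+ 2 <= S.
Proof.
move=> d0; apply: le_trans; rewrite sumr_in_setT -sumr_const_in sumr_in_set.
apply: ler_sum => v _; case: (ltP (mu + d)) => h /=; last by rewrite mul0r sqr_ge0.
by rewrite mul1r lerXn2r ?nnegrE; lra.
Qed.

(* If there are few (l+3)-cliques, few neighbourhoods are denser than a Turan graph
   with l + 1 parts, so [far_arcs_variance] makes both [far_arcs] and the variance of
   the degrees small.  Deleting the arcs xy whose co-neighbourhoods span many
   non-edges, and the vertices of high degree, then costs few arcs and leaves an
   (l+2)-clique, whose co-neighbourhoods are the parts to embed into. *)
Lemma almost_complete_multipartite (R : realType) (p r t l : nat) : (0 < p)%N ->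
  exists eta beta : R, [/\ 0 < eta, 0 < beta & exists N : nat,
    forall (T : finType) (e : rel T), symmetric e -> (N <= #|T|)%N ->
    small_sets_have_clique e p r ->
    (forall S : {set T}, beta * #|T|%:R <= #|S|%:R -> has_clique e S t) ->
    (1 - l.+2%:R^-1 - eta) * #|T|%:R ^+ 2 <= arcs R e [set: T]%SET ->
    has_clique e [set: T]%SET (r * l.+3) \/ has_clique e [set: T]%SET (t * l.+2)].
Proof.
move=> p0.
have [L LE] : {L : R | L = l.+2%:R} by exists l.+2%:R.
have [L1 L1l] : {L1 : R | L1 = l.+1%:R} by exists l.+1%:R.
have L1E : L = L1 + 1 by rewrite LE L1l natr1.
have L10 : 1 <= L1 by rewrite L1l ler1n.
have bL : 0 < (2 * L)^-1 by rewrite invr_gt0; lra.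
have [gamma [beta [gamma0 beta0 emb]]] := multipartite_embedding t l.+2 bL.
(* The Turan densities for [L1] and for [L] parts differ by 2 eps. *)
pose eps := (2 * L1 * L)^-1.
have eps0 : 0 < eps by rewrite invr_gt0 !mulr_gt0 //; lra.
(* The summands pay for the density deficit, the deleted arcs [M] and the arcs at vertices outside
   [W0]. Together they cost eta K = eps; the other eps is left for supersaturation. *)
pose K := 1 + 6 / gamma + 24 * L ^+ 2.
have g6 : 0 < 6 / gamma by apply: divr_gt0.
have K0 : 0 < K by rewrite /K; have := sqr_ge0 L; lra.
pose eta := eps / K.
have eta0 : 0 < eta by apply: divr_gt0.
have etaK : eta * K = eps by rewrite /eta divfK // gt_eqF.
have [c1 c10 Hc1] := supersaturation l eta0.
have [c2 c20 Hc2] := supersaturation l eps0.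
rewrite -L1l in Hc1 Hc2.
have [N HN] := clique_density_blowup r l.+3 p0 (mulr_gt0 c10 eta0).
exists eta, beta; split=> //; exists (maxn N 1) => T e es; rewrite -LE.
rewrite geq_max => /andP[leN T0] small lin dense.
set n : R := #|T|%:R in lin dense.
have n0 : 0 < n by rewrite ltr0n.
have li : 0 <= 1 - L1^-1 by rewrite subr_ge0 invf_le1 //; lra.
have := sum_dense_nbhds e [set: T]%SET li (ltW eta0).
set V := [set v in _ | _]%SET => sumV.
have [etaV|Veta] := leP (eta * n) (#|V|%:R).
  left; apply: HN => //.
  have VT : V \subset [set: T]%SET by apply/fintype.subsetP => v; rewrite inE.
  have h v : v \in V ->
      c1 * #|T|%:R ^+ l.+2 <= #|clique_tuples e (nbhd e [set: T]%SET v) l.+2|%:R.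
    by rewrite inE => /andP[_ dv]; apply: Hc1.
  have := supersaturation_step VT h; apply: le_trans; rewrite -/n [n ^+ l.+3]exprS.
  have -> : c1 * eta * (n * n ^+ l.+2) = c1 * (eta * n) * n ^+ l.+2 by ring.
  by rewrite ler_wpM2r ?exprn_ge0 ?(ltW n0) // ler_wpM2l // ltW.
right; rewrite finset.cardsT -/n in sumV.
have L1gt0 : 0 < L1 by lra.
have := far_arcs_variance [set: T]%SET es L1gt0; rewrite finset.cardsT -/n -L1E.
set far := far_arcs _ _ _; set vs := \sum_(v in _) (_ - _) ^+ 2.
set S := \sum_(v in _) _ in sumV *; move=> var.
have n2 : 0 < n ^+ 2 by rewrite exprn_gt0.
have far0 : 0 <= far by exact: far_arcs_ge0.
have vs0 : 0 <= vs by apply: sumr_ge0 => v _; exact: sqr_ge0.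
have L1i : 0 < L1^-1 by rewrite invr_gt0.
have vs1 : vs <= (1 + L1^-1) * vs by rewrite ler_peMl // lerDl ltW.
(* One eta comes from the vertices outside [V], one from [V], one from the density deficit. *)
have total : far + (1 + L1^-1) * vs <= 3 * eta * n ^+ 3.
  have h1 : n ^+ 2 * #|V|%:R <= n ^+ 2 * (eta * n) by rewrite ler_wpM2l ?ltW.
  have h2 : n * (- eta * n ^+ 2) <= n * (arcs R e [set: T]%SET - L1 / L * n ^+ 2).
    rewrite ler_wpM2l ?(ltW n0) // lerBrDr -mulrDl; apply: le_trans dense.
    rewrite ler_wpM2r ?(ltW n2) // (_ : L1 / L = 1 - L^-1); first lra.
    by rewrite (_ : L1 = L - 1); [field|]; lra.
  have -> : 3 * eta * n ^+ 3 = eta * n ^+ 2 * n + n ^+ 2 * (eta * n) - n * (- eta * n ^+ 2).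
    by ring.
  rewrite var; lra.
(* Here the co-neighbourhoods have at least n/(2L) vertices, the part size given to [emb]; the
   threshold lies n/(2L) above the Turan degree (1 - 1/L) n. *)
pose W0 := [set v | deg R e [set: T]%SET v <= (1 - (2 * L)^-1) * n]%SET.
have card_high : #|(~: W0)%SET|%:R <= 12 * L ^+ 2 * eta * n.
  have d0 : 0 < (2 * L)^-1 * n by rewrite mulr_gt0.
  have := @card_deviating R T e (L1 / L * n) ((2 * L)^-1 * n) (3 * eta * n ^+ 3) d0.
  have -> : L1 / L * n + (2 * L)^-1 * n = (1 - (2 * L)^-1) * n.
    by rewrite (_ : L1 = L - 1); [field|]; lra.
  have -> : [set v | (1 - (2 * L)^-1) * n < deg R e [set: T]%SET v]%SET = (~: W0)%SET.
    by apply/finset.setP => v; rewrite !inE ltNge.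
  have vsle : vs <= 3 * eta * n ^+ 3.
    by apply: le_trans vs1 _; apply: le_trans total; rewrite lerDr.
  move=> /(_ vsle)H.
  have -> : 12 * L ^+ 2 * eta * n = 3 * eta * n ^+ 3 / ((2 * L)^-1 * n) ^+ 2.
    by field; rewrite !gt_eqF //; lra.
  by rewrite ler_pdivlMr // exprn_gt0.
pose bad x y := nonarcs R e (conbhd e x) (conbhd e y).
pose e' x y := e x y && (bad x y <= gamma * n ^+ 2).
have e's : symmetric e' by move=> x y; rewrite /e' es /bad nonarcsC.
have bad0 x y : 0 <= bad x y by do 2![apply: sumr_ge0 => ? _].
pose M : R := \sum_x \sum_y (e x y && ~~ (bad x y <= gamma * n ^+ 2))%:R.
have leM : M <= 6 * eta / gamma * n ^+ 2.
  have h1 : gamma * n ^+ 2 * M <= \sum_x \sum_y (e x y)%:R * bad x y.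
    rewrite big_distrr; apply: ler_sum => x _ /=.
    rewrite big_distrr; apply: ler_sum => y _ /=.
    case: (e x y) => /=; last by rewrite mulr0 mul0r.
    by case: (leP (bad x y)) => /= h; rewrite ?mulr0 ?mulr1 mul1r // ltW.
  have h2 := sum_nonarcs_conbhd R es; rewrite -/n -/far in h2.
  have h3 : 2 * n * far <= 2 * n * (3 * eta * n ^+ 3).
    by rewrite ler_wpM2l //; lra.
  have h4 : gamma * n ^+ 2 * M <= gamma * n ^+ 2 * (6 * eta / gamma * n ^+ 2).
    apply: le_trans h1 _; apply: le_trans h2 _; apply: le_trans h3 _.
    rewrite le_eqVlt; apply/orP; left; apply/eqP; field; lra.
  by move: h4; rewrite ler_pM2l // mulr_gt0.
have arcs' : arcs R e [set: T]%SET <= arcs R e' W0 + M + 2 * n * #|(~: W0)%SET|%:R.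
  have -> : 2 * n * #|(~: W0)%SET|%:R =
      \sum_(x : T) \sum_(y : T) ((x \notin W0)%:R + (y \notin W0)%:R) :> R.
    under eq_bigr => x _ do rewrite big_split /= sumr_const -[_ *+ _]mulr_natl -/n.
    rewrite big_split /= -big_distrr /= sumr_const -[_ *+ _ as X in _ + X]mulr_natl -/n.
    have -> : \sum_x (x \notin W0)%:R = #|(~: W0)%SET|%:R :> R.
      by rewrite -natr_sum -card_set_sum; congr (#|pred_of_set _|%:R); apply/finset.setP => x; rewrite !inE.
    by ring.
  have -> : arcs R e [set: T]%SET = \sum_x \sum_y (e x y)%:R.
    by rewrite /arcs sumr_in_setT; apply: eq_bigr => x _; rewrite sumr_in_setT.
  rewrite /arcs sumr_in_set -!big_split /=; apply: ler_sum => x _.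
  rewrite sumr_in_set big_distrr /= -!big_split /=; apply: ler_sum => y _.
  rewrite !inE /e' -!natrM -!natrD ler_nat; case: (e x y); case: (bad x y <= _);
    by case: (deg R e _ x <= _); case: (deg R e _ y <= _).
have [v [sv vW ev]] : has_clique e' W0 l.+2.
  apply: clique_tuples_has_clique.
  have : c2 * n ^+ l.+2 <= #|clique_tuples e' W0 l.+2|%:R.
    apply: Hc2 => //.
    have W0n : #|W0|%:R ^+ 2 <= n ^+ 2.
      by rewrite lerXn2r ?nnegrE ?(ltW n0) // ler_nat max_card.
    have h1 : (1 - L1^-1) * #|W0|%:R ^+ 2 <= (1 - L1^-1) * n ^+ 2 by rewrite ler_wpM2l.
    have h2 : 2 * n * #|(~: W0)%SET|%:R <= 2 * n * (12 * L ^+ 2 * eta * n).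
      by rewrite ler_wpM2l //; lra.
    have h3 : eta * n ^+ 2 + 6 * eta / gamma * n ^+ 2 + 2 * n * (12 * L ^+ 2 * eta * n) =
        eps * n ^+ 2.
      by rewrite -etaK /K; field; lra.
    have h4 : (1 - L^-1) * n ^+ 2 = (1 - L1^-1) * n ^+ 2 + 2 * (eps * n ^+ 2).
      by rewrite /eps (_ : L = L1 + 1) //; field; rewrite !gt_eqF //; lra.
    have h5 : (1 - L^-1 - eta) * n ^+ 2 = (1 - L^-1) * n ^+ 2 - eta * n ^+ 2 by ring.
    rewrite h5 in dense; rewrite -/n.
    lra.
  move=> lt; rewrite -(ltr0n R); apply: lt_le_trans lt.
  by rewrite mulr_gt0 // exprn_gt0.
have [] := emb T e T0 lin (map (conbhd e) v).
- by rewrite size_map.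
- rewrite all_map; apply/allP => x xv /=; rewrite degree_le_conbhd -/n.
  by have := allP vW x xv; rewrite inE; lra.
- by rewrite pairwise_map; apply: sub_pairwise ev => x y /andP[].
by move=> c [sc _ ec]; exists c; split=> //; apply/allP => x; rewrite inE.
Qed.

(** * Ramsey-Turan densities *)

Lemma powR_natr_unbounded (R : realType) (theta C : R) : 0 < theta ->
  exists N : nat, forall n : nat, (N <= n)%N -> C <= n%:R `^ theta.
Proof.
move=> th0; have x0 : 0 <= `|C| `^ theta^-1 by exact: powR_ge0.
have := archi_boundP x0; set N := Num.bound _ => lt.
exists N => n Nn; apply: le_trans (ler_norm C) _.
have -> : `|C| = (`|C| `^ theta^-1) `^ theta.
  by rewrite -powRrM mulVf ?gt_eqF // powRr1.
apply: ge0_ler_powR; rewrite ?nnegrE //; first exact: ltW.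
by apply: ltW; apply: lt_le_trans lt _; rewrite ler_nat.
Qed.

Lemma ramsey_ratio (R : realType) (r N : nat) (theta : R) : 0 < theta ->
  (forall n : nat, (N < n)%N ->
     (ramsey r n)%:R <= (ramsey r.+1 n)%:R / n%:R `^ theta) ->
  exists M : nat, forall m, (M <= m)%N -> (4 * ramsey r m <= ramsey r.+1 m)%N.
Proof.
move=> th0 hN; have [M hM] := powR_natr_unbounded 4 th0.
exists (maxn M N.+1)%N => m; rewrite geq_max => /andP[/hM h4 /hN].
rewrite ler_pdivlMr; last by lra.
move=> h; rewrite -(ler_nat R) natrM mulrC; apply: le_trans h.
by rewrite ler_wpM2l.
Qed.

(** For t = r + 1 and m = Q(t,n), |S| >= n/q >= R(t,m)/m^theta >= R(r,m) once q <= m^theta, and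
    there is no independent set of size m. As n <= m^(2t), q <= n^(1/p) suffices when p >=
    2t/theta. *)
Lemma small_sets_of_Qmin (R : realType) (r N : nat) (theta : R) : (0 < r)%N -> 0 < theta ->
  (forall n : nat, (N < n)%N ->
     (ramsey r n)%:R <= (ramsey r.+1 n)%:R / n%:R `^ theta) ->
  exists2 p : nat, (0 < p)%N & exists N' : nat,
    forall (T : finType) (e : rel T), symmetric e -> irreflexive e -> (N' <= #|T|)%N ->
      (forall A : {set T}, indep e A -> (#|A| < Qmin r.+1 #|T|)%N) ->
      small_sets_have_clique e p r.
Proof.
move=> r0 th0 hN; set t := r.+1%N.
have x0 : 0 <= (2 * t)%:R / theta by apply: divr_ge0 => //; exact: ltW.
have := archi_boundP x0; set p := Num.bound _ => ltp.
have p0 : (0 < p)%N by rewrite -(ltr0n R) (le_lt_trans x0).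
exists p => //; exists (maxn 1 (ramsey t (maxn N.+1 t.+1)))%N => T e es ei.
rewrite geq_max => /andP[T0 leT] small S q qT Tq.
have t1 : (1 < t)%N by [].
move: leT; rewrite -leq_Qmin // geq_max; set m := Qmin t #|T| => /andP[Nm tm].
have q0 : (0 < q)%N by case: q Tq {qT} => // Tq; rewrite mul0n leqn0 in Tq; rewrite (eqP Tq) in T0.
have m0 : (0 < m)%N by apply: leq_trans tm.
have qm : q%:R <= m%:R `^ theta.
  rewrite -(@ler_pXn2r R p) ?nnegrE ?powR_ge0 //.
  apply: le_trans (_ : m%:R ^+ (2 * t) <= _).
    by rewrite -!natrX ler_nat (leq_trans qT) // vertices_le_Qmin_exp.
  rewrite -!powR_mulrn ?powR_ge0 // -powRrM; apply: ler_powR; first by rewrite ler1n.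
  by rewrite mulrC -ler_pdivrMr // ltW.
have Rm : (ramsey t m <= #|T|)%N by rewrite -leq_Qmin.
have RS : (ramsey r m <= #|S|)%N.
  rewrite -(ler_nat R); apply: le_trans (hN m Nm) _.
  have qR : 0 < q%:R :> R by rewrite ltr0n.
  rewrite ler_pdivrMr; last exact: lt_le_trans qm.
  apply: le_trans (_ : #|T|%:R <= _); first by rewrite ler_nat.
  apply: le_trans (_ : #|S|%:R * q%:R <= _); first by rewrite -natrM ler_nat mulnC.
  by rewrite ler_wpM2l.
have [//|[A _ [cA iA]]] := ramsey_set es ei RS.
by have := small A iA; rewrite cA -/m ltnn.
Qed.

(** Otherwise [S] has an independent set of size Q(t,|S|), which is at least Q(t,n)/b >= phi Q(t,n)
    because |S| >= n/b. *)
Lemma linear_sets_of_Qmin (R : realType) (t b : nat) (beta phi : R) (T : finType)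
    (e : rel T) : symmetric e -> irreflexive e -> (1 < t)%N ->
  1 <= b%:R * beta -> b%:R * phi <= 1 ->
  (forall A : {set T}, indep e A -> #|A|%:R < phi * (Qmin t #|T|)%:R) ->
  forall S : {set T}, beta * #|T|%:R <= #|S|%:R -> has_clique e S t.
Proof.
move=> es ei t1 bb bphi small S leS; apply: contrapT => nc.
have [A _ [QA iA]] := Qmin_indep es ei t1 nc.
have := small A iA; apply/negP; rewrite -leNgt.
have b0 : 0 < b%:R :> R by case: b bb {bphi} => [|b] //; rewrite mul0r; lra.
have TS : (#|T| <= b * #|S|)%N.
  rewrite -(ler_nat R) natrM; apply: le_trans (_ : b%:R * (beta * #|T|%:R) <= _).
    by rewrite mulrA ler_peMl.
  by rewrite ler_wpM2l // ltW.
rewrite -(ler_pM2l b0) mulrA; apply: le_trans (_ : (Qmin t #|T|)%:R <= _).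
  by rewrite ler_piMl.
by rewrite -natrM ler_nat (leq_trans (Qmin_mul t1 TS)) // leq_mul2l QA orbT.
Qed.

(** * Upper and lower limits of bounded sequences *)

Lemma limn_sup_infE (R : realType) (u : nat -> R) (a b : R) :
  (forall n, a <= u n <= b) -> limn_sup u = inf (range (sups u)).
Proof.
move=> ab; apply/cvg_lim => //; apply: cvg_sups_inf.
  by exists b => _ [n _ <-]; case/andP: (ab n).
by exists a => _ [n _ <-]; case/andP: (ab n).
Qed.

Lemma limn_inf_supE (R : realType) (u : nat -> R) (a b : R) :
  (forall n, a <= u n <= b) -> limn_inf u = sup (range (infs u)).
Proof.
move=> ab; apply/cvg_lim => //; apply: cvg_infs_sup.
  by exists b => _ [n _ <-]; case/andP: (ab n).
by exists a => _ [n _ <-]; case/andP: (ab n).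
Qed.

Lemma sups_ge (R : realType) (u : nat -> R) (b : R) (n m : nat) :
  (forall n, u n <= b) -> (n <= m)%N -> u m <= sups u n.
Proof.
move=> ub nm; apply: ub_le_sup; last by exists m.
by exists b => _ [k _ <-].
Qed.

Lemma infs_le (R : realType) (u : nat -> R) (a : R) (n m : nat) :
  (forall n, a <= u n) -> (n <= m)%N -> infs u n <= u m.
Proof.
move=> lb nm; apply: ge_inf; last by exists m.
by exists a => _ [k _ <-].
Qed.

Lemma limn_sup_le (R : realType) (u : nat -> R) (a b c : R) (N : nat) :
  (forall n, a <= u n <= b) -> (forall n, (N <= n)%N -> u n <= c) ->
  limn_sup u <= c.
Proof.
move=> ab uc; have ub n : u n <= b by case/andP: (ab n).
rewrite (limn_sup_infE ab); apply: (@le_trans _ _ (sups u N)).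
  apply: ge_inf; last by exists N.
  exists a => _ [n _ <-]; apply: le_trans (sups_ge ub (leqnn n)).
  by case/andP: (ab n).
apply: ge_sup; first by exists (u N); exists N => /=.
by move=> _ [m /= Nm <-]; exact: uc.
Qed.

Lemma le_limn_inf (R : realType) (u : nat -> R) (a b c : R) (N : nat) :
  (forall n, a <= u n <= b) -> (forall n, (N <= n)%N -> c <= u n) ->
  c <= limn_inf u.
Proof.
move=> ab uc; have lb n : a <= u n by case/andP: (ab n).
rewrite (limn_inf_supE ab); apply: (@le_trans _ _ (infs u N)).
  apply: lb_le_inf; first by exists (u N); exists N => /=.
  by move=> _ [m /= Nm <-]; exact: uc.
apply: ub_le_sup; last by exists N.
exists b => _ [n _ <-]; apply: le_trans (infs_le lb (leqnn n)) _.
by case/andP: (ab n).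
Qed.

Lemma limn_inf_le_sup (R : realType) (u : nat -> R) (a b : R) :
  (forall n, a <= u n <= b) -> limn_inf u <= limn_sup u.
Proof.
move=> ab; have lb n : a <= u n by case/andP: (ab n).
have ub n : u n <= b by case/andP: (ab n).
rewrite (limn_inf_supE ab) (limn_sup_infE ab).
apply: ge_sup; first by exists (infs u 0); exists 0%N.
move=> _ [n _ <-]; apply: lb_le_inf; first by exists (sups u 0); exists 0%N.
move=> _ [m _ <-]; apply: le_trans (sups_ge ub (leq_maxr n m)).
exact: infs_le lb (leq_maxl n m).
Qed.

(** * Bounds on the upper and lower densities *)

Lemma RT_le (R : realType) (n : nat) (V : finType) (H : sgraph V) (x : R) (B : R) :
  0 <= B ->
  (forall G : sgraph 'I_n, graph_free H G -> (indep_num G)%:R < x ->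
    #|edges G|%:R <= B) ->
  (RT n H x)%:R <= B.
Proof.
move=> B0 hB; rewrite /RT.
elim/big_ind: _ => // [a b ha hb|G /andP[fG ltx]]; last exact: hB.
by case: (leqP a b).
Qed.

Lemma arcs_adj (R : realType) (T : finType) (G : sgraph T) :
  arcs R (adj G) [set: T]%SET = (2 * #|edges G|)%:R.
Proof. by rewrite -sum_card_nbhd natr_sum -sum_deg. Qed.

Lemma card_edges_le (R : realType) (n : nat) (G : sgraph 'I_n) :
  #|edges G|%:R <= n%:R ^+ 2 :> R.
Proof.
have := arcs_le R (adj G) [set: 'I_n]%SET.
rewrite arcs_adj finset.cardsT card_ord; apply: le_trans.
by rewrite ler_nat leq_pmull.
Qed.

Lemma RT_density_bounds (R : realType) (V : finType) (H : sgraph V) (f : nat -> R) (n : nat) :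
  0 <= RT_density H f n <= 1.
Proof.
rewrite /RT_density divr_ge0 ?exprn_ge0 //=.
have [->|n0] := posnP n; first by rewrite expr0n invr0 mulr0.
rewrite ler_pdivrMr ?exprn_gt0 ?ltr0n // mul1r; apply: RT_le => [|G _ _].
  exact: exprn_ge0.
exact: card_edges_le.
Qed.

Lemma rhotau_upper_le (R : realType) (V : finType) (H : sgraph V) (f : nat -> R)
    (c : R) (N : nat) : 0 <= c ->
  (forall (n : nat) (G : sgraph 'I_n), (N <= n)%N -> graph_free H G ->
     (indep_num G)%:R < f n -> arcs R (adj G) [set: 'I_n]%SET <= c * n%:R ^+ 2) ->
  rhotau_upper H f <= c / 2.
Proof.
move=> c0 hN; apply: (limn_sup_le (N := maxn N 1) (RT_density_bounds H f)) => n.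
rewrite geq_max => /andP[Nn n0].
have n2 : 0 < n%:R ^+ 2 :> R by rewrite exprn_gt0 ?ltr0n.
rewrite /RT_density ler_pdivrMr //; apply: RT_le => [|G fG iG].
  by apply: mulr_ge0; [lra | exact: ltW].
by have := hN n G Nn fG iG; rewrite arcs_adj natrM; lra.
Qed.

Lemma rhotau_lower_le_upper (R : realType) (V : finType) (H : sgraph V) (f : nat -> R) :
  rhotau_lower H f <= rhotau_upper H f.
Proof. exact: limn_inf_le_sup (RT_density_bounds H f). Qed.

Lemma rhotau_lower_ge0 (R : realType) (V : finType) (H : sgraph V) (f : nat -> R) :
  0 <= rhotau_lower H f.
Proof.
apply: (le_limn_inf (N := 0) (RT_density_bounds H f)) => n _.
by case/andP: (RT_density_bounds H f n).
Qed.

Lemma rhotau_lower_Qmin (R : realType) (r l s : nat) : (0 < r)%N -> (0 < l)%N ->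
  (r * l < s)%N ->
  (exists M : nat, forall m, (M <= m)%N -> (4 * ramsey r m <= ramsey r.+1 m)%N) ->
  (1 - l%:R^-1) / 2 <= rhotau_lower (complete s) (Qfun R r.+1).
Proof.
move=> r0 l0 rls [M hM].
(* For l = 1 the bound is 0, and [Qmin_gap] could not hold, since n %/ 1 + 1 exceeds n. *)
have [l1|] := leqP l 1.
  have -> : l = 1%N by lia.
  by rewrite invr1 subrr mul0r rhotau_lower_ge0.
move=> l1; apply/ler_addgt0Pr => eps eps0; rewrite -lerBlDr.
have ei0 : 0 <= eps^-1 by rewrite invr_ge0 ltW.
have := archi_boundP ei0; set K := Num.bound _ => ltK.
(* K >= 1/eps absorbs the linear error term of [turan_blowup]; the other two entries serve
   [Qmin_gap]. *)
pose N := maxn 2 (maxn K (l * ramsey r.+1 M)).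
apply: (le_limn_inf (N := N) (RT_density_bounds (complete s) (Qfun R r.+1))) => n.
rewrite !geq_max => /and3P[n1 Kn Rn].
have [H fH iH] := QminP (n %/ l).+1 (r0 : (1 < r.+1)%N).
have [G [fG iG eG]] := turan_blowup l0 rls fH.
have gap := Qmin_gap r0 l1 hM n1 Rn.
have ltG : (indep_num G)%:R < Qfun R r.+1 n.
  by rewrite ltr_nat (leq_ltn_trans iG) // iH.
have := RT_ge fG ltG; rewrite -(ler_nat R) /RT_density.
move: eG; rewrite -(ler_nat R) natrD !natrM -(natr1 (n %/ l)).
set x : R := n%:R; set E : R := #|edges G|%:R; set Y : R := (RT _ _ _)%:R => hE EY.
have x0 : 0 < x by rewrite ltr0n; lia.
have L0 : 0 < l%:R :> R by rewrite ltr0n.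
have dv : (n %/ l)%:R <= l%:R^-1 * x.
  by rewrite mulrC ler_pdivlMr // -natrM ler_nat leq_divM.
have epsx : 1 <= eps * x.
  rewrite -ler_pdivrMl // mulr1; apply: le_trans (ltW ltK) _.
  by rewrite ler_nat.
rewrite ler_pdivlMr ?exprn_gt0 //.
have h1 : x * (n %/ l)%:R <= x * (l%:R^-1 * x) by rewrite ler_wpM2l // ltW.
have h2 : x * 1 <= x * (eps * x) by rewrite ler_wpM2l // ltW.
have h3 : 0 <= x * (eps * x) by rewrite !mulr_ge0 // ltW.
move: hE h1 h2 h3 EY; move: (l%:R^-1) => y; move: ((n %/ l)%:R) => w hE h1 h2 h3 EY.
have -> : ((1 - y) / 2 - eps) * x ^+ 2 = (x * x - x * (y * x)) / 2 - x * (eps * x) by field.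
lra.
Qed.

Lemma graph_free_no_clique (n s k : nat) (G : sgraph 'I_n) : (s <= k)%N ->
  graph_free (complete s) G -> has_clique (adj G) [set: 'I_n]%SET k -> False.
Proof.
by move=> sk /negP fG hk; apply/fG/contains_completeP; apply: has_clique_leq hk.
Qed.

Lemma rhotau_upper_Qmin (R : realType) (r l s N : nat) (theta : R) : (0 < r)%N ->
  0 < theta ->
  (forall n : nat, (N < n)%N ->
     (ramsey r n)%:R <= (ramsey r.+1 n)%:R / n%:R `^ theta) ->
  (s <= r * l.+2)%N ->
  rhotau_upper (complete s) (Qfun R r.+1) <= (1 - l.+1%:R^-1) / 2.
Proof.
move=> r0 th0 hN sr; apply/ler_addgt0Pr => eps eps0.
have [p p0 [N1 small]] := small_sets_of_Qmin r0 th0 hN.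
have eps20 : 0 < 2 * eps by lra.
have [N2 clq] := dense_graph_clique r l p0 eps20.
have li : 0 <= 1 - l.+1%:R^-1 :> R by rewrite subr_ge0 invf_le1 ?ler1n ?ltr0n.
have -> : (1 - l.+1%:R^-1) / 2 + eps = (1 - l.+1%:R^-1 + 2 * eps) / 2 by field.
apply: (@rhotau_upper_le _ _ _ _ _ (maxn N1 N2)) => [|n G].
  by rewrite addr_ge0 // ltW.
rewrite geq_max => /andP[leN1 leN2] fG iG; rewrite leNgt; apply/negP => lt.
have es : symmetric (adj G) by move=> x y; rewrite adjC.
have ei : irreflexive (adj G) by move=> x; rewrite adjxx.
apply: (graph_free_no_clique sr fG).
apply: clq; rewrite ?card_ord //; last exact: ltW.
apply: small; rewrite ?card_ord // => A iA.
by apply: leq_ltn_trans (indep_num_ge iA) _; rewrite -(ltr_nat R).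
Qed.

(** The two bounds on s match the two outcomes of [almost_complete_multipartite]; each of them
    yields a [K_s]. *)
Lemma rhotau_upper_phi_Qmin (R : realType) (r l s N : nat) (theta : R) (phi : nat -> R) :
  (0 < r)%N -> 0 < theta ->
  (forall n : nat, (N < n)%N ->
     (ramsey r n)%:R <= (ramsey r.+1 n)%:R / n%:R `^ theta) ->
  (s <= r * l.+3)%N -> (s <= r.+1 * l.+2)%N ->
  (forall d : R, 0 < d -> exists K : nat, forall n, (K <= n)%N -> phi n <= d) ->
  rhotau_upper (complete s) (fun n => phi n * Qfun R r.+1 n) < (1 - l.+2%:R^-1) / 2.
Proof.
move=> r0 th0 hN sr st hphi.
have [p p0 [N1 small]] := small_sets_of_Qmin r0 th0 hN.
have [eta0 [beta [eta00 beta0 [N2 clq]]]] := almost_complete_multipartite R r r.+1 l p0.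
(* The cap 1/4 keeps 1 - 1/(l+2) - eta non-negative, as [rhotau_upper_le] demands. *)
pose eta := Num.min eta0 4^-1.
have eta_gt0 : 0 < eta by rewrite lt_min eta00 /=; lra.
have eta_le : eta <= eta0 by rewrite ge_min lexx.
have eta_le4 : eta <= 4^-1 by rewrite ge_min lexx orbT.
have li : l.+2%:R^-1 <= 2^-1 :> R by rewrite lef_pV2 ?posrE ?ltr0n // ler_nat.
have bi0 : 0 <= beta^-1 by rewrite invr_ge0 ltW.
have := archi_boundP bi0; set b := Num.bound _ => ltb.
have b0 : 0 < b%:R :> R by apply: le_lt_trans ltb.
have bbeta : 1 <= b%:R * beta by rewrite -ler_pdivrMr // mul1r ltW.
(* phi <= 1 keeps the independence number below Q(t,n), for the small sets; phi <= 1/b serves the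
   linear ones. *)
have [K1 hK1] := hphi 1 ltr01.
have binv0 : 0 < b%:R^-1 :> R by rewrite invr_gt0.
have [K2 hK2] := hphi _ binv0.
apply: (@le_lt_trans _ _ ((1 - l.+2%:R^-1 - eta) / 2)); last first.
  by move: (l.+2%:R^-1) => y; lra.
apply: (@rhotau_upper_le _ _ _ _ _ (maxn (maxn N1 N2) (maxn K1 K2))) => [|n G].
  by move: li; move: (l.+2%:R^-1) => y; lra.
rewrite !geq_max => /andP[/andP[leN1 leN2] /andP[/hK1 phi1 /hK2 phib]] fG iG.
rewrite leNgt; apply/negP => lt.
have es : symmetric (adj G) by move=> x y; rewrite adjC.
have ei : irreflexive (adj G) by move=> x; rewrite adjxx.
have iQ A : indep (adj G) A -> #|A|%:R < phi n * (Qmin r.+1 n)%:R.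
  by move=> iA; apply: le_lt_trans iG; rewrite ler_nat indep_num_ge.
have smallG : small_sets_have_clique (adj G) p r.
  apply: small; rewrite ?card_ord // => A iA.
  rewrite -(ltr_nat R); apply: lt_le_trans (iQ A iA) _.
  by rewrite ler_piMl.
have linG (S : {set 'I_n}) : beta * #|'I_n|%:R <= #|S|%:R -> has_clique (adj G) S r.+1.
  apply: (linear_sets_of_Qmin (b := b) (phi := phi n)) => //.
    by rewrite mulrC -ler_pdivlMr // mul1r.
  by rewrite card_ord.
have leT : (N2 <= #|'I_n|)%N by rewrite card_ord.
have dense : (1 - l.+2%:R^-1 - eta0) * #|'I_n|%:R ^+ 2 <= arcs R (adj G) [set: 'I_n]%SET.
  rewrite card_ord; apply: le_trans (ltW lt); rewrite ler_wpM2r ?exprn_ge0 //.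
  by move: (l.+2%:R^-1) => y; lra.
have [] := clq _ (adj G) es leT smallG linG dense.
- exact: (graph_free_no_clique sr fG).
- exact: (graph_free_no_clique st fG).
Qed.

Theorem theorem3p10 (R : realType) (t s : nat) (ht : (2 <= t)%N) (hs : (2 <= s)%N)
  (hR : forall l : nat, l = t \/ l = t.+1 ->
    exists theta : R, 0 < theta /\
    exists N : nat, (0 < N)%N /\
    forall n : nat, (N < n)%N ->
      (ramsey l.-1 n)%:R <= (ramsey l n)%:R / n%:R `^ theta)
  (hpt : phase_transition (complete s) (Qfun R t) (Qfun R t.+1)) :
  strong_phase_transition (complete s) (Qfun R t).
Proof.
case: hpt => _ lt_pt phi phi0 phi_cvg.
have phi_small (d : R) : 0 < d -> exists K : nat, forall n, (K <= n)%N -> phi n <= d.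
  move=> d0; have /cvgrPdist_le/(_ d d0)[K _ hK] := phi_cvg.
  exists K => n /hK /=; rewrite sub0r normrN; apply: le_trans; exact: ler_norm.
split.
  have [K hK] := phi_small 1 ltr01.
  by exists K => // n /= /hK phi1; rewrite ler_piMl.
case: t ht hR lt_pt => // r r0 hR lt_pt; rewrite ltnS in r0.
have [theta [th0 [N [_ hN]]]] := hR _ (or_introl erefl).
have [theta' [th0' [N' [_ hN']]]] := hR _ (or_intror erefl).
pose l := (s.-1 %/ r)%N.
have rls : (r * l < s)%N by rewrite mulnC; have := leq_divM s.-1 r; rewrite -/l; lia.
have srl : (s <= r * l.+1)%N.
  have := ltn_ceil s.-1 r0; rewrite -/l mulnC; lia.
have [l1|] := leqP l 1.
  have sr : (s <= r * 2)%N by rewrite (leq_trans srl) // leq_mul2l ltnS l1 orbT.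
  have up := rhotau_upper_Qmin r0 th0 hN sr.
  rewrite invr1 subrr mul0r in up.
  exfalso; have := lt_le_trans lt_pt (le_trans (rhotau_lower_le_upper _ _) up).
  by rewrite ltNge (le_trans (rhotau_lower_ge0 _ _) (rhotau_lower_le_upper _ _)).
case El : l => [|[|k]] // _; rewrite El in rls srl.
have up := rhotau_upper_Qmin r0 th0 hN srl.
have ratio := ramsey_ratio th0 hN.
(* The hypothesis at t + 1 enters here: it gives the strict gap in Q(t+1,.) that the blow-up behind
   [low'] needs. *)
have ratio' := ramsey_ratio th0' hN'.
have low := rhotau_lower_Qmin R r0 (ltn0Sn _) rls ratio.
have [st|st] := leqP s (r.+1 * k.+2).
  apply: lt_le_trans low.
  exact: rhotau_upper_phi_Qmin r0 th0 hN srl st phi_small.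
exfalso; have low' := rhotau_lower_Qmin R (ltn0Sn r) (ltn0Sn _) st ratio'.
have := lt_le_trans lt_pt (le_trans (rhotau_lower_le_upper _ _) up).
move=> /(le_lt_trans (le_trans low' (rhotau_lower_le_upper _ _))).
by rewrite ltxx.
Qed.
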